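(* Let $\mathfrak g_1,\dots,\mathfrak g_n$ be complex simple Lie algebras and, for each $i$, let $T_{V_i}$ be a finite-dimensional minuscule irreducible representation of $U_q(\mathfrak g_i)$ on $V_i$. Then, in terms of the FRT-generators $(m^{\pm})^{k_i}_{j_i}$ of $U_q^{\mathrm{ext}}(\mathfrak g_i)$ associated with $T_{V_i}$, the FRT-generators $(m^\pm)^{\underline k}_{\underline j}$ of $U_q^{\mathrm{ext}}(\mathfrak g_1\oplus\cdots\oplus\mathfrak g_n)$ corresponding to its representation $T_{V_1\otimes\cdots\otimes V_n}$ are, up to isomorphism, $$(m^{+})^{\underline k}_{\underline j}=(m^{+})^{k_1}_{j_1}\otimes\cdots\otimes(m^{+})^{k_n}_{j_n}\qquad\text{and}\qquad (m^{-})^{\underline k}_{\underline j}=(m^{-})^{k_1}_{j_1}\otimes\cdots\otimes(m^{-})^{k_n}_{j_n},$$ for all multi-indices $\underline k=(k_1,\dots,k_n)$, $\underline j=(j_1,\dots,j_n)$.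
   Context: $q$ is not a root of unity ($q=e^h$ when working with the $h$-adic form $U_h$). For a semisimple $\mathfrak g$ with universal $R$-matrix $\mathscr R$ of $U_h(\mathfrak g)$ and a finite-dimensional representation $T_V$ with basis $(x_j)$, the $L$-functionals $l^\pm_{ij}$ are defined by $$(\mathrm{id}\otimes T_V)(\mathscr R)(1\otimes x_j)=\sum_k l^+_{kj}\otimes x_k,\qquad (T_V\otimes\mathrm{id})(\mathscr R^{-1})(x_j\otimes1)=\sum_i x_i\otimes l^-_{ij}.$$ The FRT-generators are $(m^\pm)^i_j:=S(l^\pm_{ij})$, $S$ the antipode; they generate the extended Hopf algebra $U_q^{\mathrm{ext}}(\mathfrak g)$, an extension of $U_q(\mathfrak g)$ by additional group-like elements (fractional powers of the $K_i$). ''Up to isomorphism'' refers to the identification $U_h(\mathfrak g_1\oplus\cdots\oplus\mathfrak g_n)\simeq U_h(\mathfrak g_1)\otimes\cdots\otimes U_h(\mathfrak g_n)$ (and the corresponding one for $U_q^{\mathrm{ext}}$). Under it the universal $R$-matrix of the left side is $(\mathscr R^1_{U_h(\mathfrak g_1)}\otimes\cdots\otimes\mathscr R^1_{U_h(\mathfrak g_n)})\otimes(\mathscr R^2_{U_h(\mathfrak g_1)}\otimes\cdots\otimes\mathscr R^2_{U_h(\mathfrak g_n)})$, where $\mathscr R=\mathscr R^1\otimes\mathscr R^2$ with summation understood. $T_{V_1\otimes\cdots\otimes V_n}$ is the factorwise representation on $V_1\otimes\cdots\otimes V_n$, with basis $x_{\underline j}=x^{(1)}_{j_1}\otimes\cdots\otimes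 x^{(n)}_{j_n}$. *)

(* Defs.v *)
From HB Require Import structures.
From mathcomp Require Import all_boot all_order all_algebra.
From mathcomp Require Import boolp classical_sets.
From mathcomp.multinomials Require Import monalg.

Set Implicit Arguments.
Unset Strict Implicit.
Unset Printing Implicit Defensive.

Import GRing.Theory Num.Theory.
Local Open Scope ring_scope.
Local Open Scope classical_set_scope.
Local Open Scope quotient_scope.

(** * Formal power series A[[h]], with h central *)

Record fps (A : Type) := Fps { fcoef : nat -> A }.
Add Printing Constructor fps.

HB.instance Definition _ (A : Type) := [isNew for @fcoef A].
HB.instance Definition _ (A : choiceType) := [Choice of fps A by <:].

Section FpsRing.
Context {A : nzRingType}.
Implicit Types f g k : fps A.

Lemma fpsP f g : (forall n, fcoef f n = fcoef g n) -> f = g.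
Proof. by case: f g => f [g] /= fg; congr Fps; apply/funext. Qed.

Definition fps0 : fps A := Fps (fun=> 0).
Definition fpsopp f := Fps (fun n => - fcoef f n).
Definition fpsadd f g := Fps (fun n => fcoef f n + fcoef g n).
Definition fpsC (a : A) := Fps (fun n => if n is 0%N then a else 0).
Definition fpsmul f g :=
  Fps (fun n => \sum_(i < n.+1) fcoef f i * fcoef g (n - i)).

Fact fpsaddA : associative fpsadd.
Proof. by move=> f g k; apply/fpsP => n /=; rewrite addrA. Qed.
Fact fpsaddC : commutative fpsadd.
Proof. by move=> f g; apply/fpsP => n /=; rewrite addrC. Qed.
Fact fpsadd0 : left_id fps0 fpsadd.
Proof. by move=> f; apply/fpsP => n /=; rewrite add0r. Qed.
Fact fpsaddN : left_inverse fps0 fpsopp fpsadd.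
Proof. by move=> f; apply/fpsP => n /=; rewrite addNr. Qed.

HB.instance Definition _ :=
  GRing.isZmodule.Build (fps A) fpsaddA fpsaddC fpsadd0 fpsaddN.

Definition trunc n f : {poly A} := \poly_(i < n) fcoef f i.

Lemma trunc_coef n f i : (i < n)%N -> (trunc n f)`_i = fcoef f i.
Proof. by move=> lin; rewrite coef_poly lin. Qed.

Lemma fpsmul_trunc n f g i : (i < n)%N ->
  fcoef (fpsmul f g) i = (trunc n f * trunc n g)`_i.
Proof.
move=> lin; rewrite coefM; apply: eq_bigr => j _.
have lji : (j <= i)%N by rewrite -ltnS.
by rewrite !trunc_coef // (leq_ltn_trans _ lin) // leq_subr.
Qed.

Lemma coefM_eq n (p p' q q' : {poly A}) :
  (forall i, (i <= n)%N -> p`_i = p'`_i) ->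
  (forall i, (i <= n)%N -> q`_i = q'`_i) -> (p * q)`_n = (p' * q')`_n.
Proof.
move=> pp qq; rewrite !coefM; apply: eq_bigr => j _.
have lji : (j <= n)%N by rewrite -ltnS.
by rewrite pp // qq // leq_subr.
Qed.

Fact fpsmulA : associative fpsmul.
Proof.
move=> f g k; apply/fpsP => n; rewrite !(@fpsmul_trunc n.+1) //.
transitivity ((trunc n.+1 f * (trunc n.+1 g * trunc n.+1 k))`_n).
  by apply: coefM_eq => // i lin; rewrite trunc_coef // (@fpsmul_trunc n.+1).
rewrite mulrA; apply: coefM_eq => // i lin.
by rewrite trunc_coef // (@fpsmul_trunc n.+1).
Qed.

Fact fpsmul1 : left_id (fpsC 1) fpsmul.
Proof.
move=> f; apply/fpsP => n /=; rewrite big_ord_recl /= mul1r subn0.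
by rewrite big1 ?addr0 // => i _; rewrite mul0r.
Qed.

Fact fps1mul : right_id (fpsC 1) fpsmul.
Proof.
move=> f; apply/fpsP => n /=; rewrite big_ord_recr /= subnn mulr1.
rewrite big1 ?add0r // => i _.
have : (0 < n - i)%N by rewrite subn_gt0.
by case: (n - i)%N => // m _; rewrite mulr0.
Qed.

Fact fpsmulDl : left_distributive fpsmul +%R.
Proof.
move=> f g k; apply/fpsP => n /=; rewrite -big_split /=.
by apply: eq_bigr => i _; rewrite mulrDl.
Qed.

Fact fpsmulDr : right_distributive fpsmul +%R.
Proof.
move=> f g k; apply/fpsP => n /=; rewrite -big_split /=.
by apply: eq_bigr => i _; rewrite mulrDr.
Qed.

Fact fps1_neq0 : fpsC 1 != 0 :> fps A.
Proof.
by apply/eqP => /(congr1 (fun f => fcoef f 0)) /= /eqP; rewrite oner_eq0.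
Qed.

HB.instance Definition _ := GRing.Zmodule_isNzRing.Build (fps A)
  fpsmulA fpsmul1 fps1mul fpsmulDl fpsmulDr fps1_neq0.

End FpsRing.

Fact fpsmulC (A : comNzRingType) : commutative (@fpsmul A).
Proof.
move=> f g; apply/fpsP => n /=; rewrite (reindex_inj rev_ord_inj) /=.
apply: eq_bigr => i _; rewrite subSS mulrC subKn // -ltnS //.
Qed.

HB.instance Definition _ (A : comNzRingType) :=
  GRing.PzRing_hasCommutativeMul.Build (fps A) (@fpsmulC A).

Definition hvar (A : nzRingType) : fps A := Fps (fun n => (n == 1%N)%:R).

(** * Algebras over C[[h]] *)

(* Rings with a central structure morphism; the zero ring is not excluded, so
   that quotients are always algebras (ssralg's lalgType assumes 1 != 0). *)
HB.mixin Record isHAlg (C : numFieldType) A of GRing.PzRing A := {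
  hscal : fps C -> A;
  hscalD : {morph hscal : a b / a + b};
  hscalM : {morph hscal : a b / a * b};
  hscal1 : hscal 1 = 1;
  hscalC : forall a x, hscal a * x = x * hscal a
}.
#[short(type="hAlgType")]
HB.structure Definition HAlg (C : numFieldType) :=
  {A of isHAlg C A & GRing.PzRing A}.

HB.instance Definition _ (C : numFieldType) :=
  @isHAlg.Build C (fps C) id (fun _ _ => erefl) (fun _ _ => erefl) erefl
    (fun a x => mulrC a x).

Section HAlgTheory.
Context {C : numFieldType}.
Implicit Types A B : hAlgType C.

Definition hpow {A} (n : nat) : A := hscal (hvar C ^+ n).
Definition cst {A} (c : C) : A := hscal (fpsC c).

Definition hcong {A} (n : nat) (x y : A) := exists z, x - y = hpow n * z.

Definition hclosed {A} (X : set A) :=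
  forall x, (forall n, exists2 y, X y & hcong n x y) -> X x.

(* e^{ht} *)
Definition hexp {A} (t : A) : A :=
  xget 0 [set y | forall n,
    hcong n y (\sum_(k < n) cst (k`!%:R^-1) * hpow k * t ^+ k)].

Definition hinv {A} (x : A) : A := xget 0 [set y | x * y = 1 /\ y * x = 1].

Definition hlinear {A B} (f : A -> B) :=
  {morph f : x y / x + y} /\ forall c x, f (hscal c * x) = hscal c * f x.

Definition halg_hom {A B} (f : A -> B) :=
  [/\ hlinear f, f 1 = 1 & {morph f : x y / x * y}].

Definition halg_antihom {A B} (f : A -> B) :=
  [/\ hlinear f, f 1 = 1 & forall x y, f (x * y) = f y * f x].

(* The C[[h]]-linear map sending g t to f t for all t.  It is used only when
   the C[[h]]-span of the g t is h-adically dense and the map exists;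
   C[[h]]-linear maps are h-adically continuous. *)
Definition linext {T : Type} {A B} (g : T -> A) (f : T -> B) : A -> B :=
  xget (fun=> 0) [set p | hlinear p /\ forall t, p (g t) = f t].

Definition hsubmod {A} (X : set A) :=
  [/\ X 0, forall x y, X x -> X y -> X (x + y)
    & forall c x, X x -> X (hscal c * x)].

Definition closed_span {A} (X : set A) : set A :=
  smallest (fun Y => hsubmod Y /\ hclosed Y) X.

Definition two_sided_ideal {A} (X : set A) :=
  [/\ X 0, forall x y, X x -> X y -> X (x - y)
    & forall a x b, X x -> X (a * x * b)].

Definition closed_ideal {A} (X : set A) : set A :=
  smallest (fun Y => two_sided_ideal Y /\ hclosed Y) X.

Lemma closed_ideal_ideal {A} (X : set A) : two_sided_ideal (closed_ideal X).
Proof.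
split=> [|x y Xx Xy|a x b Xx] Y /[dup] -[[[Y0 YB YM] _] _] XY //.
- by apply: YB; [exact: Xx|exact: Xy].
- by apply: YM; exact: Xx.
Qed.

End HAlgTheory.

(** * Quotient by the closed ideal generated by a set *)

Section HQuot.
Context {C : numFieldType} {A : hAlgType C} (X : set A).

Definition hq_eqv (x y : A) : bool := `[< closed_ideal X (x - y) >].

Fact hq_eqv_is_equiv : equiv_class_of hq_eqv.
Proof.
have [I0 IB _] := closed_ideal_ideal X.
have IN x : closed_ideal X x -> closed_ideal X (- x).
  by move=> Ix; rewrite -sub0r; exact: IB.
split=> [x|x y|y x z].
- by apply/asboolP; rewrite subrr.
- by apply/asboolP/asboolP => /IN; rewrite opprB.
- move=> /asboolP Ixy /asboolP Iyz; apply/asboolP.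
  rewrite -[x](subrK y) -addrA -[y - z]opprK; apply: IB => //; exact: IN.
Qed.

Canonical hq_equiv := EquivRelPack hq_eqv_is_equiv.
Canonical hq_encModRel := defaultEncModRel hq_eqv.

Definition hquot := {eq_quot hq_eqv}.
HB.instance Definition _ := EqQuotient.on hquot.
HB.instance Definition _ := Choice.on hquot.

Definition hpi : A -> hquot := \pi_hquot.

Lemma hpiP x y : closed_ideal X (x - y) <-> hpi x = hpi y.
Proof.
have -> : (hpi x = hpi y) <-> (x == y %[mod hquot]).
  by split=> [/eqP|/eqP].
by rewrite piE; split => [/asboolP|/asboolP].
Qed.

Lemma hpi_repr (u : hquot) : hpi (repr u) = u.
Proof. exact: reprK. Qed.

Definition hq0 := hpi 0.
Definition hq1 := hpi 1.
Definition hqopp (u : hquot) := hpi (- repr u).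
Definition hqadd (u v : hquot) := hpi (repr u + repr v).
Definition hqmul (u v : hquot) := hpi (repr u * repr v).

Let I := closed_ideal X.
Let I0 : I 0. Proof. by have [] := closed_ideal_ideal X. Qed.
Let IB x y : I x -> I y -> I (x - y).
Proof. by have [_ + _] := closed_ideal_ideal X; exact. Qed.
Let IN x : I x -> I (- x).
Proof. by move=> Ix; rewrite -sub0r; exact: IB. Qed.
Let ID x y : I x -> I y -> I (x + y).
Proof. by move=> Ix Iy; rewrite -[y]opprK; apply: IB => //; exact: IN. Qed.
Let IMr x y : I x -> I (x * y).
Proof.
by move=> Ix; rewrite -[x]mul1r; have [_ _] := closed_ideal_ideal X; exact.
Qed.
Let IMl x y : I y -> I (x * y).
Proof.
by move=> Iy; rewrite -[_ * _]mulr1; have [_ _] := closed_ideal_ideal X; exact.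
Qed.
Let repr_pi x : I (repr (hpi x) - x).
Proof. by apply/hpiP; rewrite hpi_repr. Qed.

Lemma hpiN x : hpi (- x) = hqopp (hpi x).
Proof. by apply/esym/hpiP; rewrite opprK addrC -opprB; exact: IN (repr_pi x). Qed.

Lemma hpiD x y : hpi (x + y) = hqadd (hpi x) (hpi y).
Proof. by apply/esym/hpiP; rewrite opprD addrACA; exact: ID (repr_pi x) (repr_pi y). Qed.

Lemma hpiM x y : hpi (x * y) = hqmul (hpi x) (hpi y).
Proof.
apply/esym/hpiP; set x' := repr (hpi x); set y' := repr (hpi y).
rewrite -[x' * y'](subrK (x * y')) -mulrBl -addrA -mulrBr.
by rewrite addrC; apply: ID; [exact: IMl (repr_pi y)|exact: IMr (repr_pi x)].
Qed.

Let surj (P : hquot -> Prop) : (forall x, P (hpi x)) -> forall u, P u.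
Proof. by move=> Px u; rewrite -(hpi_repr u). Qed.

Fact hqaddA : associative hqadd.
Proof. by do 3!elim/surj => ?; rewrite -!hpiD addrA. Qed.
Fact hqaddC : commutative hqadd.
Proof. by do 2!elim/surj => ?; rewrite -!hpiD addrC. Qed.
Fact hqadd0 : left_id hq0 hqadd.
Proof. by elim/surj => ?; rewrite -!hpiD add0r. Qed.
Fact hqaddN : left_inverse hq0 hqopp hqadd.
Proof. by elim/surj => ?; rewrite -hpiN -!hpiD addNr. Qed.
Fact hqmulA : associative hqmul.
Proof. by do 3!elim/surj => ?; rewrite -!hpiM mulrA. Qed.
Fact hqmul1 : left_id hq1 hqmul.
Proof. by elim/surj => ?; rewrite -!hpiM mul1r. Qed.
Fact hq1mul : right_id hq1 hqmul.
Proof. by elim/surj => ?; rewrite -!hpiM mulr1. Qed.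
Fact hqmulDl : left_distributive hqmul hqadd.
Proof. by do 3!elim/surj => ?; rewrite -hpiD -!hpiM -hpiD mulrDl. Qed.
Fact hqmulDr : right_distributive hqmul hqadd.
Proof. by do 3!elim/surj => ?; rewrite -hpiD -!hpiM -hpiD mulrDr. Qed.
HB.instance Definition _ :=
  GRing.isZmodule.Build hquot hqaddA hqaddC hqadd0 hqaddN.
HB.instance Definition _ := GRing.Zmodule_isPzRing.Build hquot
  hqmulA hqmul1 hq1mul hqmulDl hqmulDr.

Fact hq_scalD : {morph hpi \o hscal : a b / a + b : fps C >-> a + b}.
Proof. by move=> a b /=; rewrite hscalD hpiD. Qed.
Fact hq_scalM : {morph hpi \o hscal : a b / a * b : fps C >-> a * b}.
Proof. by move=> a b /=; rewrite hscalM hpiM. Qed.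
Fact hq_scal1 : (hpi \o hscal) 1 = 1.
Proof. by rewrite /= hscal1. Qed.
Fact hq_scalC (a : fps C) (u : hquot) : (hpi \o hscal) a * u = u * (hpi \o hscal) a.
Proof. by elim/surj: u => x; rewrite -[LHS]hpiM -[RHS]hpiM hscalC. Qed.
HB.instance Definition _ :=
  isHAlg.Build C hquot hq_scalD hq_scalM hq_scal1 hq_scalC.

End HQuot.

(** * The h-adic free algebra C<T>[[h]] *)

Section FreeAlg.
Context (C : numFieldType) (T : choiceType).

Definition free_halg := fps {malg C[{fmonom T}]}.
HB.instance Definition _ := GRing.NzRing.on free_halg.

Definition free_scal (a : fps C) : free_halg :=
  Fps (fun n => (fcoef a n)%:MP).

Fact free_scalD : {morph free_scal : a b / a + b}.
Proof. by move=> a b; apply/fpsP => n /=; rewrite raddfD. Qed.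
Fact free_scalM : {morph free_scal : a b / a * b}.
Proof.
move=> a b; apply/fpsP => n /=; rewrite raddf_sum /=.
by apply: eq_bigr => i _; rewrite rmorphM.
Qed.
Fact free_scal1 : free_scal 1 = 1.
Proof. by apply/fpsP => -[|n] /=; rewrite ?mpolyC1E ?raddf0. Qed.
Fact malgC_central (c : C) (x : {malg C[{fmonom T}]}) : c%:MP * x = x * c%:MP.
Proof.
rewrite !malgM_def fgmulUg fgmulgU; apply: eq_bigr => k _.
by rewrite mulrC mul1m mulm1.
Qed.
Fact free_scalC a (x : free_halg) : free_scal a * x = x * free_scal a.
Proof.
apply/fpsP => n /=; rewrite (reindex_inj rev_ord_inj) /=.
apply: eq_bigr => i _; rewrite subSS malgC_central subKn // -ltnS //.
Qed.
HB.instance Definition _ :=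
  isHAlg.Build C free_halg free_scalD free_scalM free_scal1 free_scalC.

Definition fgen (t : T) : free_halg := fpsC << fmu t >>.

End FreeAlg.

(** * Completed tensor products of C[[h]]-algebras *)

(* The h-adic algebra generated by symbols [u], one for each tuple u of
   elements of the factors, subject to multilinearity over C[[h]] and to
   factorwise multiplication. *)
Section CTens.
Context {C : numFieldType} {I : finType} (U : I -> hAlgType C).

Definition tens_tuple := forall i, U i.
HB.instance Definition _ := Choice.on tens_tuple.

Local Notation "<[ u ]>" := (fgen C (u : tens_tuple)).

Inductive ctens_rel : set (free_halg C tens_tuple) :=
| ctens_one : ctens_rel (<[ fun=> 1 ]> - 1)
| ctens_mul (u v : tens_tuple) :
    ctens_rel (<[ fun i => u i * v i ]> - <[ u ]> * <[ v ]>)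
| ctens_add (u : tens_tuple) i (a b : U i) :
    ctens_rel (<[ dfwith u (a + b) ]> - <[ dfwith u a ]> - <[ dfwith u b ]>)
| ctens_scal (u : tens_tuple) i (c : fps C) (a : U i) :
    ctens_rel (<[ dfwith u (hscal c * a) ]> - hscal c * <[ dfwith u a ]>).

Definition ctens : hAlgType C := hquot ctens_rel.

Definition pure (u : forall i, U i) : ctens := hpi ctens_rel <[ u ]>.

End CTens.

Section TensorPowers.
Context {C : numFieldType} {U : hAlgType C}.

Definition ctens2 : hAlgType C := ctens (fun _ : 'I_2 => U).
Definition ctens3 : hAlgType C := ctens (fun _ : 'I_3 => U).

Definition pure2 (a b : U) : ctens2 :=
  pure (fun k : 'I_2 => if k == 0 then a else b).
Definition pure3 (a b c : U) : ctens3 :=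
  pure (fun k : 'I_3 => if k == 0 then a else if k == 1 then b else c).

Definition flip : ctens2 -> ctens2 :=
  linext (fun ab : U * U => pure2 ab.1 ab.2) (fun ab => pure2 ab.2 ab.1).

Definition leg12 : ctens2 -> ctens3 :=
  linext (fun ab : U * U => pure2 ab.1 ab.2) (fun ab => pure3 ab.1 ab.2 1).
Definition leg13 : ctens2 -> ctens3 :=
  linext (fun ab : U * U => pure2 ab.1 ab.2) (fun ab => pure3 ab.1 1 ab.2).
Definition leg23 : ctens2 -> ctens3 :=
  linext (fun ab : U * U => pure2 ab.1 ab.2) (fun ab => pure3 1 ab.1 ab.2).

(* D (x) id and id (x) D *)
Definition tens_l (D : U -> ctens2) : ctens2 -> ctens3 :=
  linext (fun ab : U * U => pure2 ab.1 ab.2)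
         (fun ab => leg12 (D ab.1) * pure3 1 1 ab.2).
Definition tens_r (D : U -> ctens2) : ctens2 -> ctens3 :=
  linext (fun ab : U * U => pure2 ab.1 ab.2)
         (fun ab => pure3 ab.1 1 1 * leg23 (D ab.2)).

End TensorPowers.
Arguments ctens2 {C} U.
Arguments ctens3 {C} U.

Definition tens_map {C : numFieldType} {U V : hAlgType C} (f : U -> V) :
    ctens2 U -> ctens2 V :=
  linext (fun ab : U * U => pure2 ab.1 ab.2) (fun ab => pure2 (f ab.1) (f ab.2)).

(* (a_1 (x) b_1) (x) ... (x) (a_n (x) b_n)
     |-> (a_1 (x) ... (x) a_n) (x) (b_1 (x) ... (x) b_n) *)
Definition shuffle {C : numFieldType} {I : finType} (U : I -> hAlgType C) :
    ctens (fun i => ctens2 (U i)) -> ctens2 (ctens U) :=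
  linext (fun ab : (forall i, U i) * (forall i, U i) =>
            pure (fun i => pure2 (ab.1 i) (ab.2 i)))
         (fun ab => pure2 (pure ab.1) (pure ab.2)).

(** * Cartan data *)

(* A complex semisimple Lie algebra is given by its Cartan matrix
   a_ij = <alpha_j, alpha_i^vee> and d_i = (alpha_i, alpha_i) / 2. *)
Record cartan := Cartan {
  cI : finType;
  ca : cI -> cI -> int;
  cd : cI -> nat
}.

Definition finite_type (g : cartan) :=
  [/\ forall i : cI g, ca i i = 2,
      forall i j : cI g, i != j -> ca i j <= 0,
      forall i : cI g, (0 < cd i)%N,
      forall i j : cI g, (cd i)%:Z * ca i j = (cd j)%:Z * ca j i
    & forall x : cI g -> rat, (exists i, x i != 0) ->
        0 < \sum_i \sum_j x i * x j * ((cd i)%:Z * ca i j)%:~R].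

Definition indecomposable (g : cartan) :=
  forall P : pred (cI g), (exists i, P i) -> (exists j, ~~ P j) ->
    exists i j, [/\ P i, ~~ P j & ca i j != 0].

(* Short roots are normalized by d_i = 1. *)
Definition simple_type (g : cartan) :=
  [/\ finite_type g, indecomposable g & exists i : cI g, cd i = 1%N].

Definition dsum (n : nat) (g : 'I_n -> cartan) : cartan :=
  @Cartan {i : 'I_n & cI (g i)}
    (fun u v => if tag u == tag v then ca (tagged u) (tagged_as u v) else 0)
    (fun u => cd (tagged u)).

(** * The h-adic quantum group U_h(g) *)

Inductive gen (I : Type) := GH of I | GE of I | GF of I.
HB.instance Definition _ (I : Type) := gen_eqMixin (gen I).
HB.instance Definition _ (I : Type) := gen_choiceMixin (gen I).

Section Uh.
Context (C : numFieldType).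

(* q^z with q = e^h *)
Definition qpow (z : int) : fps C := hexp (z%:~R : fps C).

(* Symmetric Gaussian binomial coefficients at q^d. *)
Fixpoint qbin (d m k : nat) {struct m} : fps C :=
  match m, k with
  | _, 0%N => 1
  | 0%N, _ => 0
  | m'.+1, k'.+1 =>
      qpow (d%:Z * k'.+1%:Z) * qbin d m' k'.+1
      + qpow (- (d%:Z * (m'%:Z - k'%:Z))) * qbin d m' k'
  end.

Context (g : cartan).

Local Notation Free := (free_halg C (gen (cI g))).
Local Notation H i := (fgen C (GH i) : Free).
Local Notation E i := (fgen C (GE i) : Free).
Local Notation F i := (fgen C (GF i) : Free).

Definition serre (X : cI g -> Free) (i j : cI g) : Free :=
  let m := `|1 - ca i j|%N in
  \sum_(k < m.+1)
    (-1) ^+ k * hscal (qbin (cd i) m k) * X i ^+ (m - k) * X j * X i ^+ k.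

(* In uh_EF, E_i F_j - F_j E_i - r is the unique solution s of
   (q_i - q_i^-1) s = delta_ij (K_i - K_i^-1), as Free has no h-torsion and
   the right-hand side is divisible by h. *)
Inductive uh_rel : set Free :=
| uh_HH i j : uh_rel (H i * H j - H j * H i)
| uh_HE i j : uh_rel (H i * E j - E j * H i - E j *~ ca i j)
| uh_HF i j : uh_rel (H i * F j - F j * H i + F j *~ ca i j)
| uh_EF i j (r : Free) :
    hscal (qpow (cd i)%:Z - qpow (- (cd i)%:Z)) * (E i * F j - F j * E i - r)
      = (hexp (H i *+ cd i) - hexp (- (H i *+ cd i))) *+ (i == j) ->
    uh_rel r
| uh_EE i j : i != j -> uh_rel (serre (fun l => E l) i j)
| uh_FF i j : i != j -> uh_rel (serre (fun l => F l) i j).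

Definition Uh : hAlgType C := hquot uh_rel.
Definition ugen (x : gen (cI g)) : Uh := hpi uh_rel (fgen C x).

End Uh.

Section Hopf.
Context (C : numFieldType) (g : cartan).
Local Notation U := (Uh C g).
Local Notation H i := (ugen C (GH i) : U).
Local Notation E i := (ugen C (GE i) : U).
Local Notation F i := (ugen C (GF i) : U).

Definition uK (i : cI g) : U := hexp (H i *+ cd i).
Definition uKV (i : cI g) : U := hexp (- (H i *+ cd i)).

Record uh_hopf := UhHopf {
  coprod : U -> ctens2 U;
  counit : U -> fps C;
  antipode : U -> U;
  coprod_hom : halg_hom coprod;
  coprodH : forall i, coprod (H i) = pure2 (H i) 1 + pure2 1 (H i);
  coprodE : forall i, coprod (E i) = pure2 (E i) (uK i) + pure2 1 (E i);
  coprodF : forall i, coprod (F i) = pure2 (F i) 1 + pure2 (uKV i) (F i);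
  counit_hom : halg_hom counit;
  counit_gen : forall x, counit (ugen C x) = 0;
  antipode_antihom : halg_antihom antipode;
  antipodeH : forall i, antipode (H i) = - H i;
  antipodeE : forall i, antipode (E i) = - (E i * uKV i);
  antipodeF : forall i, antipode (F i) = - (uK i * F i)
}.

(** * The universal R-matrix *)

Definition quasitriangular (D : uh_hopf) (R : ctens2 U) :=
  [/\ exists R', R * R' = 1 /\ R' * R = 1,
      forall x, flip (coprod D x) * R = R * coprod D x,
      tens_l (coprod D) R = leg13 R * leg23 R
    & tens_r (coprod D) R = leg13 R * leg12 R].

(* Products of E's (x) products of F's, both nonempty. *)
Definition EF_words : set (ctens2 U) :=
  [set x | exists s t : seq (cI g), [/\ s != [::], t != [::]
     & x = pure2 (\prod_(i <- s) E i) (\prod_(i <- t) F i)]].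

(* R = exp(h sum_ij B_ij H_i (x) H_j) (1 + Theta), where B is the inverse of
   the matrix (d_j^-1 a_ij) and Theta lies in U_h(n+)^{>0} (x) U_h(n-)^{<0}.
   Together with quasitriangularity, this singles out the standard R-matrix
   (among, e.g., R and the inverse of its flip). *)
Definition standard_form (R : ctens2 U) :=
  exists (B : cI g -> cI g -> rat) (Theta : ctens2 U),
    [/\ forall i j, \sum_k B i k * ((ca k j)%:~R / (cd j)%:R) = (i == j)%:R,
        closed_span EF_words Theta
      & R = hexp (\sum_i \sum_j cst (ratr (B i j)) * pure2 (H i) (H j))
              * (1 + Theta)].

Definition universal_R (D : uh_hopf) (R : ctens2 U) :=
  quasitriangular D R /\ standard_form R.

(** * Representations *)

Section Rep.
Context {J : finType}.

(* A matrix representation on the free C[[h]]-module V[[h]] with basis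
   (x_j)_{j : J}: u x_j = sum_k T u k j x_k. *)
Definition representation (T : U -> J -> J -> fps C) :=
  [/\ forall k j, hlinear (fun u => T u k j),
      forall k j, T 1 k j = (k == j)%:R
    & forall u v k j, T (u * v) k j = \sum_l T u k l * T v l j].

Definition rep_act (T : U -> J -> J -> fps C) (u : U) (v : J -> fps C) :=
  fun k => \sum_j T u k j * v j.

(* Irreducibility of V((h)) over C((h)) = Frac C[[h]]: subspaces of V((h))
   correspond to h-saturated submodules of V[[h]]. *)
Definition irreducible (T : U -> J -> J -> fps C) :=
  (0 < #|J|)%N /\
  forall W : set (J -> fps C),
    W (fun=> 0) ->
    (forall c v w, W v -> W w -> W (fun k => c * v k + w k)) ->
    (forall v, W (fun k => hvar C * v k) -> W v) ->
    (forall u v, W v -> W (rep_act T u v)) ->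
    (forall v, W v -> v = (fun=> 0)) \/ (forall v, W v).

(* mu i = <mu, alpha_i^vee> *)
Definition is_weight (T : U -> J -> J -> fps C) (mu : cI g -> int) :=
  exists v : J -> fps C, v <> (fun=> 0) /\
    forall i, rep_act T (H i) v = (fun k => (mu i)%:~R * v k).

Definition refl (i : cI g) (mu : cI g -> int) : cI g -> int :=
  fun j => mu j - ca j i * mu i.

Definition minuscule (T : U -> J -> J -> fps C) :=
  forall mu nu, is_weight T mu -> is_weight T nu ->
    exists w : seq (cI g), nu = foldr refl mu w.

(** * L-functionals and FRT-generators *)

(* l^+_kj is the (k,j) entry of (id (x) T)(R) in U (x) End(V), and l^-_ij the
   (i,j) entry of (T (x) id)(R^-1) in End(V) (x) U. *)
Definition lplus (R : ctens2 U) (T : U -> J -> J -> fps C) (k j : J) : U :=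
  linext (fun ab : U * U => pure2 ab.1 ab.2)
         (fun ab => hscal (T ab.2 k j) * ab.1) R.
Definition lminus (R : ctens2 U) (T : U -> J -> J -> fps C) (i j : J) : U :=
  linext (fun ab : U * U => pure2 ab.1 ab.2)
         (fun ab => hscal (T ab.1 i j) * ab.2) (hinv R).

Definition mplus (D : uh_hopf) R T (i j : J) : U := antipode D (lplus R T i j).
Definition mminus (D : uh_hopf) R T (i j : J) : U := antipode D (lminus R T i j).

End Rep.
End Hopf.

(* The factorwise action of U_1 (x) ... (x) U_n on V_1 (x) ... (x) V_n. *)
Definition tens_rep {C : numFieldType} {n : nat} (U : 'I_n -> hAlgType C)
    (J : 'I_n -> finType) (T : forall i, U i -> J i -> J i -> fps C) :
    ctens U -> {dffun forall i, J i} -> {dffun forall i, J i} -> fps C :=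
  fun x k j =>
    linext (@pure C 'I_n U) (fun u => \prod_i T i (u i) (k i) (j i)) x.

Definition dsum_gen {n : nat} (g : 'I_n -> cartan) (i : 'I_n)
    (x : gen (cI (g i))) : gen (cI (dsum g)) :=
  match x with
  | GH a => GH (Tagged (fun i => cI (g i)) a : cI (dsum g))
  | GE a => GE (Tagged (fun i => cI (g i)) a : cI (dsum g))
  | GF a => GF (Tagged (fun i => cI (g i)) a : cI (dsum g))
  end.

(* phi : U_h(g_1 + ... + g_n) ~ U_h(g_1) (x) ... (x) U_h(g_n) is the canonical
   isomorphism: it sends the generator x of the i-th summand to
   1 (x) ... (x) x (x) ... (x) 1. *)
Definition dsum_iso {C : numFieldType} {n : nat} (g : 'I_n -> cartan)
    (phi : Uh C (dsum g) -> ctens (fun i => Uh C (g i))) :=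
  [/\ halg_hom phi, bijective phi
    & forall i (x : gen (cI (g i))),
        phi (ugen C (dsum_gen x)) =
        pure (dfwith (fun i => 1 : Uh C (g i)) (ugen C x))].

(* Main.v *)
(** The quantum group of the direct sum is generated by commuting copies
    [iota_i : U_h(g_i) -> U_h(g_1 + ... + g_n)], so the universal property of
    the completed tensor product gives an algebra isomorphism with the tensor
    product of the [U_h(g_i)].  Its coproduct, counit and antipode are glued
    from those of the factors, and its R-matrix is the product of the commuting
    elements [(iota_i (x) iota_i)(R_i)].  Every identity to be checked is between
    continuous linear maps, so it only has to be checked on pure tensors. *)

Require Import Defs.
From mathcomp Require Import all_boot all_order all_algebra.
From mathcomp Require Import boolp classical_sets.
From mathcomp Require Import finmap.
From mathcomp.multinomials Require Import monalg.
From mathcomp Require Import reals complex.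

Set Implicit Arguments.
Unset Strict Implicit.
Unset Printing Implicit Defensive.

Import GRing.Theory Num.Theory.

(** * Linear maps and convergence in the h-adic topology *)

Section HadicTheory.
Local Open Scope ring_scope.
Local Open Scope classical_set_scope.

Context {C : numFieldType}.
Implicit Types A B D : hAlgType C.

(** [linext] and [hexp] are picked by [xget], with a default value when nothing qualifies, so
    nothing can be computed with them before existence and uniqueness are known. Separatedness of
    the target (plus density of the family, for [linext]) gives uniqueness; completeness is what
    allows a candidate to be built. Both properties pass from the free algebra to its quotients
    because the ideals divided out are h-adically closed. Two obstacles shape the rest. The tensor
    product is presented as an algebra, while antipodes and the slices of $R$ that define the
    $L$-functionals are only linear; such maps are therefore built as linear maps on words and shown
    to kill a two-sided ideal. Moreover, the relation for $[E_i,F_j]$ is implicit: its $r$ is any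
    solution of an equation. Tracing such an $r$ back to one summand requires $q^d-q^{-d}$ not to be
    a zero divisor, which holds because it is $h$ times a unit for $d>0$. An FRT-generator is an
    antipode applied to a slice of $R$ or $R^{-1}$ by a matrix coefficient, and each of these
    operations acts factor by factor. *)

Lemma hscal0 A : hscal 0 = 0 :> A.
Proof. by apply: (addrI (hscal 0)); rewrite -hscalD !addr0. Qed.

Lemma hscalN A a : hscal (- a) = - hscal a :> A.
Proof. by apply: (addrI (hscal a)); rewrite -hscalD !subrr hscal0. Qed.

Lemma hscal_sum A I (r : seq I) (P : pred I) (a : I -> fps C) :
  hscal (\sum_(i <- r | P i) a i) = \sum_(i <- r | P i) hscal (a i) :> A.
Proof. by apply: big_morph; [exact: hscalD|exact: hscal0]. Qed.

Lemma hscal_prod A I (r : seq I) (P : pred I) (a : I -> fps C) :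
  hscal (\prod_(i <- r | P i) a i) = \prod_(i <- r | P i) hscal (a i) :> A.
Proof. by apply: big_morph; [exact: hscalM|exact: hscal1]. Qed.

Lemma hscalCA A a (x y : A) : x * (hscal a * y) = hscal a * (x * y).
Proof. by rewrite mulrA -hscalC mulrA. Qed.

Lemma hpow0 A : hpow 0 = 1 :> A.
Proof. by rewrite /hpow expr0 hscal1. Qed.

Lemma hpowD A m n : hpow (m + n) = hpow m * hpow n :> A.
Proof. by rewrite /hpow exprD hscalM. Qed.

Lemma hpowC A n (x : A) : hpow n * x = x * hpow n.
Proof. exact: hscalC. Qed.

Lemma hpowCA A n (x y : A) : x * (hpow n * y) = hpow n * (x * y).
Proof. exact: hscalCA. Qed.

Lemma cst0 A : cst 0 = 0 :> A.
Proof.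
rewrite /cst (_ : fpsC 0 = 0) ?hscal0 //.
by apply: fpsP => -[].
Qed.

Lemma cst1 A : cst 1 = 1 :> A.
Proof. by rewrite /cst (_ : fpsC 1 = 1) ?hscal1. Qed.

Lemma cstD A : {morph @cst C A : a b / a + b}.
Proof.
move=> a b; rewrite /cst -hscalD; congr hscal.
by apply: fpsP => -[|n] //=; rewrite addr0.
Qed.

Lemma cstM A : {morph @cst C A : a b / a * b}.
Proof.
move=> a b; rewrite /cst -hscalM; congr hscal.
apply: fpsP => -[|n] /=; first by rewrite big_ord1.
by rewrite big_ord_recl /= big1 ?mulr0 ?addr0 // => i _; rewrite mul0r.
Qed.

Lemma fcoef_sum (D : nzRingType) I (r : seq I) (P : pred I) (f : I -> fps D) n :
  fcoef (\sum_(i <- r | P i) f i) n = \sum_(i <- r | P i) fcoef (f i) n.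
Proof.
by elim/big_rec2: _ => //= i y x _ <-.
Qed.

Lemma fcoef_hvarM (D : nzRingType) (f : fps D) n :
  fcoef (hvar D * f) n = if n is m.+1 then fcoef f m else 0.
Proof.
case: n => [|n]; rewrite /= ?big_ord1 /= ?mul0r //.
rewrite big_ord_recl /= mul0r add0r big_ord_recl /= mul1r subSS subn0.
by rewrite big1 ?addr0 // => i _; rewrite /= mul0r.
Qed.

Lemma fcoef_hvarXM (D : nzRingType) (f : fps D) m n :
  fcoef (hvar D ^+ m * f) n = if (n < m)%N then 0 else fcoef f (n - m).
Proof.
elim: m n => [|m IH] n; first by rewrite expr0 mul1r subn0.
by rewrite exprS -mulrA fcoef_hvarM; case: n => // n; rewrite IH ltnS subSS.
Qed.

(** * Congruences modulo $h^n$ and the truncated Cauchy product *)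

Section Hcong.
Context {A : hAlgType C}.
Implicit Types x y z : A.

Lemma hcong_refl n x : hcong n x x.
Proof. by exists 0; rewrite subrr mulr0. Qed.

Lemma hcong_sym n x y : hcong n x y -> hcong n y x.
Proof. by move=> [z e]; exists (- z); rewrite mulrN -e opprB. Qed.

Lemma hcong_trans n y x z : hcong n x y -> hcong n y z -> hcong n x z.
Proof.
move=> [u e] [v e']; exists (u + v).
by rewrite mulrDr -e -e' addrA subrK.
Qed.

Lemma hcong_add n x y x' y' :
  hcong n x y -> hcong n x' y' -> hcong n (x + x') (y + y').
Proof.
by move=> [u e] [v e']; exists (u + v); rewrite mulrDr -e -e' opprD addrACA.
Qed.

Lemma hcong_mull n a x y : hcong n x y -> hcong n (a * x) (a * y).
Proof. by move=> [u e]; exists (a * u); rewrite -mulrBr e hpowCA. Qed.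

Lemma hcong_mulr n a x y : hcong n x y -> hcong n (x * a) (y * a).
Proof. by move=> [u e]; exists (u * a); rewrite -mulrBl e mulrA. Qed.

Lemma hcong_mul n x y x' y' :
  hcong n x y -> hcong n x' y' -> hcong n (x * x') (y * y').
Proof.
by move=> e e'; apply: hcong_trans (hcong_mulr _ e) (hcong_mull _ e').
Qed.

Lemma hcong_sum n I (r : seq I) (P : pred I) (f g : I -> A) :
  (forall i, P i -> hcong n (f i) (g i)) ->
  hcong n (\sum_(i <- r | P i) f i) (\sum_(i <- r | P i) g i).
Proof.
move=> e; elim/big_rec2: _ => [|i y x Pi xy]; first exact: hcong_refl.
by apply: hcong_add xy; exact: e.
Qed.

Lemma hcong_hpow n x : hcong n (hpow n * x) 0.
Proof. by exists x; rewrite subr0. Qed.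

Lemma hcong_pow_sum m n (a : nat -> A) : (m <= n)%N ->
  hcong m (\sum_(k < n) hpow k * a k) (\sum_(k < m) hpow k * a k).
Proof.
move=> /subnKC<-; rewrite big_split_ord /= -[X in hcong _ _ X]addr0.
apply: hcong_add; first exact: hcong_refl.
apply: (hcong_trans (y := \sum_(k < n - m) 0)); last first.
  by rewrite big1 //; exact: hcong_refl.
by apply: hcong_sum => i _; rewrite hpowD -mulrA; exact: hcong_hpow.
Qed.

(** Summing the triangle $i+k<n$ by rows $i$ leaves an inner sum with only $n-i$ terms. Completing
    it to $n$ terms costs a multiple of $h^{n-i}$, and the factor $h^i$ of the row turns this into a
    multiple of $h^n$. *)
Lemma hcong_cauchy n (a b : nat -> A) :
  hcong n ((\sum_(k < n) hpow k * a k) * (\sum_(k < n) hpow k * b k))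
          (\sum_(k < n) hpow k * \sum_(i < k.+1) a i * b (k - i)%N).
Proof.
have -> : \sum_(k < n) hpow k * (\sum_(i < k.+1) a i * b (k - i)%N)
    = \sum_(i < n) hpow i * a i * \sum_(k < n - i) hpow k * b k.
  under eq_bigr => k _.
    rewrite mulr_sumr (big_ord_widen n (fun i => hpow k * (a i * b (k - i)%N))) //.
    over.
  rewrite (exchange_big_dep xpredT) //=; apply: eq_bigr => i _.
  rewrite -(big_mkord (fun k => (i < k.+1)%N)
             (fun k => hpow k * (a i * b (k - i)%N))).
  rewrite -(big_mkord xpredT (fun k => hpow k * b k)).
  rewrite (@big_cat_nat _ _ _ i) //= ?(ltnW (ltn_ord i)) //.
  rewrite big_nat_cond big_pred0 ?add0r; last first.
    by move=> k; rewrite ltnS; case: ltnP; rewrite ?andbF // => ? /ltnW.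
  rewrite -{1}[i : nat]add0n big_addn mulr_sumr big_mkcond /=.
  apply: eq_bigr => k _; rewrite ltnS leq_addl addnK.
  by rewrite addnC hpowD -!mulrA; congr (_ * _); rewrite hpowCA.
rewrite mulr_suml; apply: hcong_sum => i _.
rewrite -!mulrA; set S := \sum_(_ < n) _; set S' := \sum_(_ < n - i) _.
have [z e] : hcong (n - i) S S' by apply: hcong_pow_sum; rewrite leq_subr.
(* Here $h^i h^{n-i}=h^n$ is recovered from the row factor and the error [z]. *)
exists (a i * z).
by rewrite -mulrBr -mulrBr e hpowCA !mulrA -hpowD subnKC // ltnW.
Qed.

End Hcong.

Definition hsep A := forall x : A, (forall n, hcong n x 0) -> x = 0.

Definition hcauchy A (a : nat -> A) := forall n, hcong n (a n.+1) (a n).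

Definition hcomplete A := hsep A /\
  forall a : nat -> A, hcauchy a -> exists x, forall n, hcong n x (a n).

Lemma hsep_eq A : hsep A -> forall x y : A, (forall n, hcong n x y) -> x = y.
Proof.
move=> sA x y e; apply/eqP; rewrite -subr_eq0; apply/eqP/sA => n.
by rewrite -(subrr y); apply: hcong_add (e n) (hcong_refl _ _).
Qed.

Lemma hcauchy_pow_sum A (a : nat -> A) : hcauchy (fun n => \sum_(k < n) hpow k * a k).
Proof. by move=> n; exact: hcong_pow_sum. Qed.

(** * Linear maps, homomorphisms, and uniqueness by density *)

Section Hlinear.
Context {A B : hAlgType C} {f : A -> B}.
Hypothesis fL : hlinear f.

Lemma hlinD : {morph f : x y / x + y}. Proof. by case: fL. Qed.
Lemma hlinZ c x : f (hscal c * x) = hscal c * f x. Proof. by case: fL. Qed.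
Lemma hlin0 : f 0 = 0.
Proof. by apply: (addrI (f 0)); rewrite -hlinD !addr0. Qed.
Lemma hlinN : {morph f : x / - x}.
Proof. by move=> x; apply: (addrI (f x)); rewrite -hlinD !subrr hlin0. Qed.
Lemma hlinB : {morph f : x y / x - y}.
Proof. by move=> x y; rewrite hlinD hlinN. Qed.
Lemma hlin_sum I (r : seq I) (P : pred I) (x : I -> A) :
  f (\sum_(i <- r | P i) x i) = \sum_(i <- r | P i) f (x i).
Proof. by apply: big_morph; [exact: hlinD|exact: hlin0]. Qed.
Lemma hlin_mulrn n x : f (x *+ n) = f x *+ n.
Proof. by elim: n => [|n IH]; rewrite ?mulr0n ?hlin0 // !mulrS hlinD IH. Qed.
Lemma hlin_mulrz n x : f (x *~ n) = f x *~ n.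
Proof. by case: n => n; rewrite ?NegzE ?mulrNz ?hlinN -pmulrn hlin_mulrn. Qed.
Lemma hlin_hpow n x : f (hpow n * x) = hpow n * f x. Proof. exact: hlinZ. Qed.
Lemma hlin_hcong n x y : hcong n x y -> hcong n (f x) (f y).
Proof. by move=> [z e]; exists (f z); rewrite -hlin_hpow -e hlinB. Qed.

End Hlinear.

Lemma hlinear_id A : hlinear (@id A). Proof. by []. Qed.

Lemma hlinear0 A B : hlinear (fun _ : A => 0 : B).
Proof. by split=> [x y|c x]; rewrite ?addr0 ?mulr0. Qed.

Lemma hlinear_comp A B D (f : B -> D) (g : A -> B) :
  hlinear f -> hlinear g -> hlinear (f \o g).
Proof.
by move=> fL gL; split=> [x y|c x] /=; rewrite ?(hlinD gL) ?(hlinZ gL) ?(hlinD fL) ?(hlinZ fL).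
Qed.

Lemma hlinear_mull A B (f : A -> B) b : hlinear f -> hlinear (fun x => b * f x).
Proof. by move=> fL; split=> [x y|c x]; rewrite ?(hlinD fL) ?(hlinZ fL) ?mulrDr ?hscalCA. Qed.

Lemma hlinear_mulr A B (f : A -> B) b : hlinear f -> hlinear (fun x => f x * b).
Proof. by move=> fL; split=> [x y|c x]; rewrite ?(hlinD fL) ?(hlinZ fL) ?mulrDl ?mulrA. Qed.

Lemma hlinear_hscal A B (f : A -> fps C) (b : B) :
  hlinear f -> hlinear (fun x => hscal (f x) * b).
Proof.
by move=> fL; split=> [x y|c x]; rewrite ?(hlinD fL) ?(hlinZ fL) ?hscalD ?hscalM ?mulrDl ?mulrA.
Qed.

Section HalgHom.
Context {A B : hAlgType C} {f : A -> B}.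
Hypothesis fH : halg_hom f.

Lemma hom_lin : hlinear f. Proof. by case: fH. Qed.
Lemma hom1 : f 1 = 1. Proof. by case: fH. Qed.
Lemma homM : {morph f : x y / x * y}. Proof. by case: fH. Qed.
Lemma hom_hscal c : f (hscal c) = hscal c.
Proof. by rewrite -[hscal c]mulr1 (hlinZ hom_lin) hom1 mulr1. Qed.
Lemma hom_prod I (r : seq I) (P : pred I) (x : I -> A) :
  f (\prod_(i <- r | P i) x i) = \prod_(i <- r | P i) f (x i).
Proof. by apply: big_morph; [exact: homM|exact: hom1]. Qed.
Lemma homX n : {morph f : x / x ^+ n}.
Proof. by move=> x; elim: n => [|n IH]; rewrite ?hom1 // !exprS homM IH. Qed.

End HalgHom.

Lemma hom_id A : halg_hom (@id A). Proof. by []. Qed.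

Lemma hom_comp A B D (f : B -> D) (g : A -> B) :
  halg_hom f -> halg_hom g -> halg_hom (f \o g).
Proof.
move=> fH gH; split=> [||x y] /=; first exact: hlinear_comp (hom_lin fH) (hom_lin gH).
  by rewrite (hom1 gH) (hom1 fH).
by rewrite (homM gH) (homM fH).
Qed.

Section Hclosed.
Context {A B : hAlgType C}.

(** Linear maps satisfy $f(h^nz)=h^nf(z)$ and are therefore continuous; in a separated target,
    agreement on approximations modulo every $h^n$ is agreement. *)
Lemma hclosed_eq (f g : A -> B) : hsep B -> hlinear f -> hlinear g ->
  hclosed [set x | f x = g x].
Proof.
move=> sB fL gL x clx; apply: (hsep_eq sB) => n.
have [y /= e xy] := clx n.
apply: hcong_trans (hlin_hcong fL xy) _; rewrite e.
exact/hcong_sym/(hlin_hcong gL).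
Qed.

Lemma hsubmod_eq (f g : A -> B) : hlinear f -> hlinear g ->
  hsubmod [set x | f x = g x].
Proof.
move=> fL gL; split=> /= [|x y e e'|c x e]; first by rewrite (hlin0 fL) (hlin0 gL).
- by rewrite (hlinD fL) (hlinD gL) e e'.
- by rewrite (hlinZ fL) (hlinZ gL) e.
Qed.

Lemma hclosed_preim (f : A -> B) Y : hlinear f -> hclosed Y ->
  hclosed (f @^-1` Y).
Proof.
move=> fL clY x clx; apply: clY => n; have [y Yy xy] := clx n.
by exists (f y) => //; exact: hlin_hcong.
Qed.

Lemma hsubmod_preim (f : A -> B) Y : hlinear f -> hsubmod Y ->
  hsubmod (f @^-1` Y).
Proof.
move=> fL [Y0 YD YZ]; split=> /= [|x y Yx Yy|c x Yx]; first by rewrite (hlin0 fL).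
- by rewrite (hlinD fL); exact: YD.
- by rewrite (hlinZ fL); exact: YZ.
Qed.

End Hclosed.

Lemma hsubmod_sum A (Y : set A) I (r : seq I) (P : pred I) (x : I -> A) :
  hsubmod Y -> (forall i, P i -> Y (x i)) -> Y (\sum_(i <- r | P i) x i).
Proof. by move=> [Y0 YD _] Yx; elim/big_ind: _. Qed.

Lemma closed_spanP A (X : set A) : hsubmod (closed_span X) /\ hclosed (closed_span X).
Proof.
split; first split.
- by move=> Y [[[]]].
- by move=> x y cx cy Y /[dup] -[[[_ YD _] _] _] cY; apply: YD; [exact: cx|exact: cy].
- by move=> c x cx Y /[dup] -[[[_ _ YZ] _] _] cY; apply: YZ; exact: cx.
- move=> x clx Y /[dup] -[[_ clY] _] cY; apply: clY => n.
  by have [y cy xy] := clx n; exists y => //; exact: cy.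
Qed.

Lemma closed_span_sub A (X : set A) : X `<=` closed_span X.
Proof. by move=> x Xx Y [_]; apply. Qed.

(* The C[[h]]-span of the family g is h-adically dense. *)
Definition htotal {T : Type} {A} (g : T -> A) := forall Y : set A,
  hsubmod Y -> hclosed Y -> (forall t, Y (g t)) -> forall x, Y x.

Section Htotal.
Context {T : Type} {A B : hAlgType C}.

Lemma htotal_eq (g : T -> A) (p q : A -> B) : hsep B -> htotal g ->
  hlinear p -> hlinear q -> (forall t, p (g t) = q (g t)) -> p =1 q.
Proof.
by move=> sB gT pL qL e; apply: gT e; [exact: hsubmod_eq|exact: hclosed_eq].
Qed.

Lemma htotal_comp (f : A -> B) (g : T -> A) : hlinear f ->
  (forall y, exists x, f x = y) -> htotal g -> htotal (f \o g).
Proof.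
move=> fL fS gT Y sY cY Yg y; have [x <-] := fS y.
by apply: (gT (f @^-1` Y)) x => //; [exact: hsubmod_preim|exact: hclosed_preim].
Qed.

Lemma linext_eq (g : T -> A) (p : A -> B) : hsep B -> htotal g -> hlinear p ->
  linext g (p \o g) = p.
Proof.
move=> sB gT pL; rewrite /linext; case: xgetP => [q _ [qL e]|/(_ p)[]//].
by apply/funext; exact: htotal_eq e.
Qed.

(** This is how every [linext] is evaluated: density makes the chosen map unique, so exhibiting one
    linear map with the right values identifies it. *)
Lemma linextE (g : T -> A) (f : T -> B) (p : A -> B) : hsep B -> htotal g ->
  hlinear p -> (forall t, p (g t) = f t) -> linext g f = p.
Proof.
move=> sB gT pL e; rewrite -(linext_eq sB gT pL); congr linext.
by apply/funext=> t; rewrite /= e.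
Qed.

End Htotal.

Lemma hinvE A (x y : A) : x * y = 1 -> y * x = 1 -> hinv x = y.
Proof.
move=> xy yx; apply: xget_unique => // z [_ zx].
by rewrite -[z]mulr1 -xy mulrA zx mul1r.
Qed.

(** * The exponential $e^{ht}$ *)

Section Hexp.

Definition hexp_sum A (t : A) n : A :=
  \sum_(k < n) cst (k`!%:R^-1) * hpow k * t ^+ k.

Lemma hexp_sumE A (t : A) n :
  hexp_sum t n = \sum_(k < n) hpow k * (cst (k`!%:R^-1) * t ^+ k).
Proof. by apply: eq_bigr => k _; rewrite -hpowC mulrA. Qed.

Lemma hexpP A (t : A) : hcomplete A -> forall n, hcong n (hexp t) (hexp_sum t n).
Proof.
move=> [_ cA]; have : exists y, forall n, hcong n y (hexp_sum t n).
  apply: cA => n; rewrite !hexp_sumE.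
  exact: (hcong_pow_sum (fun k => cst (k`!%:R^-1) * t ^+ k) (leqnSn n)).
exact: (@xgetPex _ 0 [set y | forall n, hcong n y (hexp_sum t n)]).
Qed.

Lemma hexp_unique A (t y : A) : hsep A -> (forall n, hcong n y (hexp_sum t n)) -> hexp t = y.
Proof.
move=> sA ty; apply: xget_unique => // z tz; apply: (hsep_eq sA) => n.
exact: hcong_trans (tz n) (hcong_sym (ty n)).
Qed.

Lemma hom_hexp A B (f : A -> B) t : hcomplete A -> hsep B -> halg_hom f ->
  f (hexp t) = hexp (f t).
Proof.
move=> cA sB fH; apply/esym/hexp_unique => // n.
have fL := hom_lin fH.
have -> : hexp_sum (f t) n = f (hexp_sum t n).
  rewrite !hexp_sumE (hlin_sum fL); apply: eq_bigr => k _.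
  by rewrite (hlin_hpow fL) (hlinZ fL) (homX fH).
by apply: (hlin_hcong fL); exact: hexpP.
Qed.

Lemma hexp0 A : hsep A -> hexp 0 = 1 :> A.
Proof.
move=> sA; apply: hexp_unique => // -[|n]; first by exists (1 - hexp_sum 0 0); rewrite hpow0 mul1r.
rewrite hexp_sumE big_ord_recl /= fact0 invr1 cst1 expr0 hpow0 !mulr1 big1 ?addr0.
  exact: hcong_refl.
by move=> i _; rewrite exprS mul0r !mulr0.
Qed.

Lemma hexpD A (x y : A) : hcomplete A -> x * y = y * x ->
  hexp (x + y) = hexp x * hexp y.
Proof.
move=> cA xy; apply: hexp_unique => [|n]; first by case: cA.
apply: hcong_trans (hcong_mul (hexpP x cA n) (hexpP y cA n)) _.
rewrite !hexp_sumE.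
set a := fun k : nat => cst k`!%:R^-1 * x ^+ k.
set b := fun k : nat => cst k`!%:R^-1 * y ^+ k.
rewrite (_ : \sum_(k < n) hpow k * (_ * (x + y) ^+ k) =
  \sum_(k < n) hpow k * (\sum_(i < k.+1) a i * b (k - i)%N)).
  exact: hcong_cauchy.
apply: eq_bigr => k _; congr (_ * _).
rewrite addrC exprDn_comm // mulr_sumr; apply: eq_bigr => i _.
have ik : (i <= k)%N by rewrite -ltnS.
have -> : y ^+ (k - i) * x ^+ i = x ^+ i * y ^+ (k - i).
  by apply: commrX; apply/commr_sym/commrX.
rewrite /a /b -mulrA hscalCA mulrA -cstM -[X in _ * X = _]mulr_natl mulrA; congr (_ * _).
(* Moving the binomial coefficient into the field [C] reduces the claim to $\binom
   ki/k!=1/(i!\,(k-i)!)$, where factorials are invertible by characteristic 0. *)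
have -> : 'C(k, i)%:R = cst 'C(k, i)%:R :> A.
  elim: 'C(k, i) => [|m IH]; first by rewrite cst0.
  by rewrite -!natr1 cstD cst1 IH.
rewrite -cstM; congr cst; rewrite -(bin_fact ik) !natrM.
have fn m : m`!%:R != 0 :> C by rewrite pnatr_eq0 -lt0n fact_gt0.
rewrite invfM [LHS]mulrC mulVKf ?invfM //.
by rewrite pnatr_eq0 -lt0n bin_gt0.
Qed.

Lemma hexp_sum_comm A I (r : seq I) (P : pred I) (t : I -> A) : hcomplete A ->
  (forall i j, t i * t j = t j * t i) ->
  hexp (\sum_(i <- r | P i) t i) = \prod_(i <- r | P i) hexp (t i).
Proof.
move=> cA tC; elim: r => [|i r IH]; first by rewrite !big_nil hexp0 //; case: cA.
rewrite !big_cons; case: (P i) => //; rewrite hexpD ?IH //.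
by rewrite mulr_sumr mulr_suml; apply: eq_bigr.
Qed.

End Hexp.

End HadicTheory.

(** * Free algebras and quotients *)

Section FpsComplete.
Local Open Scope ring_scope.
Context {D : nzRingType}.
Implicit Types x y : fps D.

Lemma fps_hvarX_dvd n x : (forall k, (k < n)%N -> fcoef x k = 0) ->
  exists z, x = hvar D ^+ n * z.
Proof.
move=> x0; exists (Fps (fun k => fcoef x (k + n))); apply: fpsP => k.
by rewrite fcoef_hvarXM; case: ltnP => [/x0//|/subnK/= ->].
Qed.

Lemma fps_hvarX_coef n x y z k : x - y = hvar D ^+ n * z -> (k < n)%N ->
  fcoef x k = fcoef y k.
Proof.
move=> e kn; have := congr1 (fun f => fcoef f k) e; rewrite fcoef_hvarXM kn /=.
by move/eqP; rewrite subr_eq0 => /eqP.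
Qed.

Lemma fps_sep x : (forall n, exists z, x - 0 = hvar D ^+ n * z) -> x = 0.
Proof.
move=> x0; apply: fpsP => k; have [z e] := x0 k.+1.
exact: (fps_hvarX_coef e).
Qed.

Lemma fps_lim (a : nat -> fps D) :
  (forall n, exists z, a n.+1 - a n = hvar D ^+ n * z) ->
  exists x, forall n, exists z, x - a n = hvar D ^+ n * z.
Proof.
(* Coefficient [k] no longer changes from the term [a k.+1] on, so it is read off there. *)
move=> ca; exists (Fps (fun k => fcoef (a k.+1) k)) => n.
apply: fps_hvarX_dvd => k kn; apply/eqP; rewrite /= subr_eq0; apply/eqP.
rewrite -(subnK kn); elim: (n - _)%N => // m ->.
have [z e] := ca (m + k.+1)%N.
by rewrite addSn; apply/esym/(fps_hvarX_coef e); rewrite addnS ltnS leq_addl.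
Qed.

End FpsComplete.

Section FreeTheory.
Local Open Scope ring_scope.
Local Open Scope classical_set_scope.
Context {C : numFieldType}.

Lemma fps_complete : hcomplete (fps C : hAlgType C).
Proof. by split; [exact: fps_sep|exact: fps_lim]. Qed.

Context {T : choiceType}.
Local Notation Free := (free_halg C T).

Lemma free_hpowE n : hpow n = hvar {malg C[{fmonom T}]} ^+ n :> Free.
Proof.
have e : free_scal T (hvar C) = hvar _.
  by apply: fpsP => -[|[|m]] /=; rewrite ?raddf0 ?mpolyC1E.
rewrite /hpow; elim: n => [|n IH]; first by rewrite !expr0 hscal1.
by rewrite !exprS hscalM IH -e.
Qed.

Lemma free_complete : hcomplete Free.
Proof.
split=> [x x0|a ca].
  by apply: fps_sep => n; have [z] := x0 n; rewrite free_hpowE; exists z.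
have [|x xP] := @fps_lim _ a.
  by move=> n; have [z] := ca n; rewrite free_hpowE; exists z.
by exists x => n; rewrite /hcong free_hpowE.
Qed.

(* c is h times a unit, so it is not a zero divisor. *)
Lemma free_hscal_reg (c : fps C) (x : Free) :
  fcoef c 0 = 0 -> fcoef c 1 != 0 -> hscal c * x = 0 -> x = 0.
Proof.
move=> c0 c1 cx; apply: fpsP => n; elim/ltn_ind: n => n IH.
(* Coefficient $n+1$ of $cx$ is $c_1x_n$ plus terms in $x_m$ with $m<n$, which vanish by
   induction. *)
have := congr1 (fun f => fcoef f n.+1) cx => /=.
rewrite !big_ord_recl /= c0 raddf0 mul0r add0r big1 => [|i _]; last first.
  by rewrite IH ?mulr0 // /bump /= subSS ltn_subrL //= (leq_ltn_trans _ (ltn_ord i)).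
rewrite addr0 subSS subn0 /= mul_malgC => e.
by rewrite -[LHS]scale1r -(mulVf c1) -scalerA e scaler0.
Qed.

Definition word (s : seq T) : Free := \prod_(t <- s) fgen C t.

Lemma wordE (s : seq T) : word s = fpsC << FMonom s >>.
Proof.
rewrite /word; elim: s => [|t s IH].
  by rewrite big_nil -fmoneE.
rewrite big_cons IH; apply: fpsP => -[|n] /=.
  rewrite big_ord1 /= malgM_def fgmulUU mulr1; congr << _ >>.
  by apply: val_inj; rewrite /= fmM fmU.
by rewrite big1 // => -[[|i] ?] _ /=; rewrite ?mul0r // mulr0.
Qed.

Lemma fpsC_malgE (m : {malg C[{fmonom T}]}) :
  fpsC m = \sum_(w <- msupp m) cst (m@_w) * word (fmonom_val w) :> Free.
Proof.
apply: fpsP => n; rewrite fcoef_sum /=; case: n => [|n].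
  rewrite [LHS]monalgE; apply: eq_bigr => w _.
  rewrite big_ord1 /= wordE /= mul_malgC; apply/malgP => k.
  by rewrite mcoeffZ !mcoeffU fmK; case: eqP; rewrite ?mulr1 ?mulr0.
rewrite big1 // => w _; rewrite big1 // => -[[|i] ?] _ /=.
  by rewrite wordE /= mulr0.
by rewrite raddf0 mul0r.
Qed.

Lemma free_hcong_coef n (x : Free) :
  hcong n x (\sum_(k < n) hpow k * (fpsC (fcoef x k) : Free)).
Proof.
rewrite /hcong free_hpowE; apply: fps_hvarX_dvd => k kn /=.
rewrite fcoef_sum (bigD1 (Ordinal kn)) // big1 ?addr0.
  by rewrite free_hpowE fcoef_hvarXM /= ltnn subnn /= addr0 subrr.
move=> i /andP[_]; rewrite free_hpowE fcoef_hvarXM -val_eqE /= => ik.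
case: ltngtP ik => //= ki _.
by move: ki; rewrite -subn_gt0; case: (k - i)%N.
Qed.

(** Modulo $h^n$ only the first $n$ coefficients of a series matter, and each is a noncommutative
    polynomial, hence a finite combination of words. *)
Lemma word_total : htotal word.
Proof.
move=> Y sY cY Yw x; apply: cY => n; exists (\sum_(k < n) hpow k * (fpsC (fcoef x k) : Free)).
  have [_ _ YZ] := sY.
  apply: hsubmod_sum => // k _; apply: (YZ).
  by rewrite fpsC_malgE; apply: hsubmod_sum => // w _; exact: YZ.
exact: free_hcong_coef.
Qed.

(** * Linear maps on the free algebra with arbitrary prescribed values on words *)

Section WordLift.
Context {B : hAlgType C} (F : seq T -> B).

Definition malg_lift (m : {malg C[{fmonom T}]}) : B :=
  \sum_(w <- msupp m) cst (m@_w) * F (fmonom_val w).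

Lemma malg_liftEw (d : {fset {fmonom T}}) m : (msupp m `<=` d)%fset ->
  malg_lift m = \sum_(w <- d) cst (m@_w) * F (fmonom_val w).
Proof.
move=> le; rewrite /malg_lift; apply: big_fset_incl => // w _ /mcoeff_outdom ->.
by rewrite cst0 mul0r.
Qed.

Lemma malg_liftD : {morph malg_lift : x y / x + y}.
Proof.
move=> x y; rewrite (malg_liftEw (msuppD_le _ _)).
rewrite (malg_liftEw (fsubsetUl (msupp x) (msupp y))).
rewrite (malg_liftEw (fsubsetUr (msupp x) (msupp y))) -big_split /=.
by apply: eq_bigr => w _; rewrite mcoeffD cstD mulrDl.
Qed.

Lemma malg_lift0 : malg_lift 0 = 0.
Proof. by rewrite /malg_lift msupp0 big_seq_fset0. Qed.

Lemma malg_lift_sum I (r : seq I) (P : pred I) x :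
  malg_lift (\sum_(i <- r | P i) x i) = \sum_(i <- r | P i) malg_lift (x i).
Proof. by apply: big_morph; [exact: malg_liftD|exact: malg_lift0]. Qed.

Lemma malg_liftZ c x : malg_lift (c%:MP * x) = cst c * malg_lift x.
Proof.
rewrite mul_malgC (malg_liftEw (msuppZ_le _ _)) mulr_sumr.
by apply: eq_bigr => w _; rewrite mcoeffZ cstM mulrA.
Qed.

Lemma malg_lift_word s : malg_lift << FMonom s >> = F s.
Proof.
rewrite (malg_liftEw msuppU_le) big_seq_fset1 mcoeffUU.
by rewrite cst1 mul1r.
Qed.

(* Locked, like mlift and csum below: unfolding it makes unification explode. *)
Definition word_lift : Free -> B := locked (fun x => xget 0 [set y | forall n,
  hcong n y (\sum_(k < n) hpow k * malg_lift (fcoef x k))]).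

Hypothesis cB : hcomplete B.

Lemma word_liftP x n :
  hcong n (word_lift x) (\sum_(k < n) hpow k * malg_lift (fcoef x k)).
Proof.
rewrite /word_lift -lock; have [_ /(_ _ (hcauchy_pow_sum (fun k => malg_lift (fcoef x k))))] := cB.
by move=> /(@xgetPex _ (0 : B) [set y | forall n, hcong n y _]); exact.
Qed.

Lemma word_lift_unique x y :
  (forall n, hcong n y (\sum_(k < n) hpow k * malg_lift (fcoef x k))) ->
  word_lift x = y.
Proof.
move=> yP; have [sB _] := cB; apply: (hsep_eq sB) => n.
exact: hcong_trans (word_liftP x n) (hcong_sym (yP n)).
Qed.

Lemma word_lift_lin : hlinear word_lift.
Proof.
split=> [x y|c x]; apply: word_lift_unique => n.
  under eq_bigr do rewrite malg_liftD mulrDr.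
  by rewrite big_split; exact: hcong_add (word_liftP x n) (word_liftP y n).
(* The scalar is itself a power series; truncating it as well exhibits the product with [x] as a
   Cauchy product. *)
have cP : hcong n (hscal c : B) (\sum_(k < n) hpow k * cst (fcoef c k)).
  have [z e] : exists z, c - \sum_(k < n) hvar C ^+ k * fpsC (fcoef c k) = hvar C ^+ n * z.
    apply: fps_hvarX_dvd => k kn /=.
    rewrite fcoef_sum (bigD1 (Ordinal kn)) // big1 ?addr0.
      by rewrite fcoef_hvarXM /= ltnn subnn /= addr0 subrr.
    move=> i /andP[_]; rewrite fcoef_hvarXM -val_eqE /= => ik.
    case: ltngtP ik => //= ki _.
    by move: ki; rewrite -subn_gt0; case: (k - i)%N.
  exists (hscal z); rewrite /hpow -hscalM -e hscalD hscalN hscal_sum.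
  by under [in RHS]eq_bigr do rewrite hscalM.
apply: hcong_trans (hcong_mul cP (word_liftP x n)) _.
have := hcong_cauchy n (fun k => cst (fcoef c k) : B) (fun k => malg_lift (fcoef x k)).
congr hcong; apply: eq_bigr => k _; congr (_ * _).
by rewrite /= malg_lift_sum; apply: eq_bigr => i _; rewrite malg_liftZ.
Qed.

Lemma word_lift_word s : word_lift (word s) = F s.
Proof.
apply: word_lift_unique => -[|n].
  by exists (F s - \sum_(k < 0) hpow k * malg_lift (fcoef (word s) k)); rewrite hpow0 mul1r.
rewrite wordE big_ord_recl /= malg_lift_word hpow0 mul1r big1 ?addr0; first exact: hcong_refl.
by move=> i _; rewrite malg_lift0 mulr0.
Qed.

End WordLift.

Lemma word_cat s t : word (s ++ t) = word s * word t.
Proof. exact: big_cat. Qed.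

Lemma word1 t : word [:: t] = fgen C t.
Proof. exact: big_seq1. Qed.

Definition gen_lift {B : hAlgType C} (f : T -> B) : Free -> B :=
  word_lift (fun s => \prod_(t <- s) f t).

Section GenLift.
Context {B : hAlgType C} (f : T -> B) (cB : hcomplete B).

Lemma gen_lift_hom : halg_hom (gen_lift f).
Proof.
have fL := word_lift_lin (fun s => \prod_(t <- s) f t) cB.
split=> //.
  have := word_lift_word (fun s => \prod_(t <- s) f t) cB [::].
  by rewrite /word !big_nil.
have [sB _] := cB.
have hw s t : gen_lift f (word s * word t) = gen_lift f (word s) * gen_lift f (word t).
  by rewrite -word_cat /gen_lift !word_lift_word // big_cat.
have hl s : (fun y => gen_lift f (word s * y)) =1 (fun y => gen_lift f (word s) * gen_lift f y).
  apply: htotal_eq sB word_total _ _ (hw s); last exact: hlinear_mull.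
  by apply: (hlinear_comp fL); apply: hlinear_mull (hlinear_id _).
move=> x y; move: x; apply: (htotal_eq sB word_total) => [||s].
- by apply: (hlinear_comp fL); apply: hlinear_mulr (hlinear_id _).
- exact: hlinear_mulr.
- exact: hl.
Qed.

Lemma gen_liftE t : gen_lift f (fgen C t) = f t.
Proof. by rewrite -word1 /gen_lift word_lift_word // big_seq1. Qed.

End GenLift.

Lemma gen_hom_eq {B : hAlgType C} (f g : Free -> B) : hsep B ->
  halg_hom f -> halg_hom g -> (forall t, f (fgen C t) = g (fgen C t)) -> f =1 g.
Proof.
move=> sB fH gH e; apply: (htotal_eq sB word_total) => [||s].
- exact: hom_lin.
- exact: hom_lin.
- by rewrite (hom_prod fH) (hom_prod gH); apply: eq_bigr.
Qed.

End FreeTheory.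

Section QuotTheory.
Local Open Scope ring_scope.
Local Open Scope classical_set_scope.
Context {C : numFieldType} {A : hAlgType C} (X : set A).

Lemma hpi_hom : halg_hom (hpi X).
Proof.
split=> [||x y]; [split=> [x y|c x]| |]; rewrite ?hpiD ?hpiM //.
Qed.

Lemma hpi_surj u : exists x, hpi X x = u.
Proof. by exists (repr u); exact: hpi_repr. Qed.

Lemma hpi_eq0 x : X x -> hpi X x = 0.
Proof. by move=> Xx; apply/hpiP; rewrite subr0 => Y [_]; apply. Qed.

(** Separatedness is exactly closedness of the ideal: a lift [x] of an element divisible by every
    $h^n$ is approximated by the elements $x-h^nz$ of the ideal. For limits, the increments of the
    sequence are lifted rather than its terms, so that the lifts form a convergent series in [A]. *)
Lemma hquot_complete : hcomplete A -> hcomplete (hquot X).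
Proof.
move=> [_ cA]; have piL := hom_lin hpi_hom; split=> [u u0|a ca].
  have [x xu] := hpi_surj u; rewrite -xu; apply/hpiP; rewrite subr0.
  move=> Y /[dup] -[[iY clY] _] XY; apply: clY => n.
  have [v e] := u0 n; have [z zv] := hpi_surj v.
  exists (x - hpow n * z); last by exists z; rewrite opprB addrCA subrr addr0.
  suff : closed_ideal X (x - hpow n * z) by exact.
  by apply/hpiP; rewrite xu -[u]subr0 e -zv (hlin_hpow piL).
(* Arbitrary lifts of the terms [a n] need not be Cauchy; lifts of the quotients by $h^n$ of the
   increments always give a Cauchy series. *)
have zP n : exists z, a n.+1 - a n = hpow n * hpi X z.
  by have [v e] := ca n; have [z zv] := hpi_surj v; exists z; rewrite zv.
have {zP} [z zP] := choice zP.
have [y yP] := cA _ (hcauchy_pow_sum z).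
have [x xa] := hpi_surj (a 0%N).
exists (hpi X (x + y)) => n.
have -> : a n = hpi X (x + \sum_(k < n) hpow k * z k).
  rewrite (hlinD piL) (hlin_sum piL) xa; elim: n => [|n IH].
    by rewrite big_ord0 addr0.
  rewrite big_ord_recr /= addrA -IH (hlin_hpow piL) -zP.
  by rewrite addrC subrK.
by apply: (hlin_hcong piL); apply: hcong_add (yP n); exact: hcong_refl.
Qed.

Lemma hquot_hom_eq {B : hAlgType C} (f g : hquot X -> B) :
  f \o hpi X =1 g \o hpi X -> f =1 g.
Proof. by move=> e u; have [x <-] := hpi_surj u; exact: e. Qed.

Section Lift.
Context {B : hAlgType C} (f : A -> B).

(** Evaluation at a representative makes the map total without any proof argument; that it factors
    [f] is shown separately. *)
Definition hquot_lift (u : hquot X) : B := f (repr u).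

Hypothesis sB : hsep B.
Hypothesis fL : hlinear f.
Hypothesis fX : forall a x b, X x -> f (a * x * b) = 0.

(** Since [f] is only linear, its kernel need not be an ideal. The set of [y] with
    [f (a * y * b) = 0] for all [a], [b] is a two-sided ideal, is closed by continuity of [f], and
    contains [X]; hence it contains the closed ideal of [X]. *)
Lemma hquot_liftE x : hquot_lift (hpi X x) = f x.
Proof.
have : closed_ideal X (repr (hpi X x) - x) by apply/hpiP; rewrite hpi_repr.
suff I0 y : closed_ideal X y -> f y = 0.
  by move=> /I0; rewrite (hlinB fL) => /eqP; rewrite subr_eq0 => /eqP.
suff: closed_ideal X `<=` [set y | forall a b, f (a * y * b) = 0].
  by move=> sI /sI /(_ 1 1); rewrite mul1r mulr1.
move=> {}y; apply; split=> [|z Xz a b]; last exact: fX.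
split; first split=> /= [a b|z z' Iz Iz' a b|a z b Iz a' b'].
- by rewrite mulr0 mul0r (hlin0 fL).
- by rewrite mulrBr mulrBl (hlinB fL) Iz Iz' subrr.
- by rewrite !mulrA -[_ * a * _ * _ * _]mulrA Iz.
move=> z clz a b; apply: sB => n; have [z' /= Iz' zz'] := clz n.
rewrite -(Iz' a b); apply: (hlin_hcong fL).
by apply: hcong_mulr; exact: hcong_mull.
Qed.

Lemma hquot_lift_lin : hlinear hquot_lift.
Proof.
split=> [u v|c u].
  have [[x <-] [y <-]] := (hpi_surj u, hpi_surj v).
  by rewrite -(hlinD (hom_lin hpi_hom)) !hquot_liftE (hlinD fL).
have [x <-] := hpi_surj u.
by rewrite -(hlinZ (hom_lin hpi_hom)) !hquot_liftE (hlinZ fL).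
Qed.

End Lift.

Section HomLift.
Context {B : hAlgType C} (f : A -> B) (sB : hsep B) (fH : halg_hom f).
Hypothesis fX : forall x, X x -> f x = 0.

Let fX' a x b : X x -> f (a * x * b) = 0.
Proof. by move=> Xx; rewrite !(homM fH) (fX Xx) mulr0 mul0r. Qed.

Lemma hquot_lift_homE x : hquot_lift f (hpi X x) = f x.
Proof. exact: hquot_liftE sB (hom_lin fH) fX' x. Qed.

Lemma hquot_lift_hom : halg_hom (hquot_lift f).
Proof.
split=> [||u v]; first exact: hquot_lift_lin sB (hom_lin fH) fX'.
  by rewrite -(hom1 hpi_hom) hquot_lift_homE (hom1 fH).
have [[x <-] [y <-]] := (hpi_surj u, hpi_surj v).
by rewrite -(homM hpi_hom) !hquot_lift_homE (homM fH).
Qed.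

End HomLift.

End QuotTheory.

(** * Completed tensor products *)

Section ProdLemmas.
Local Open Scope ring_scope.
Context {B : pzRingType} {I : eqType}.

Lemma prodr_only1 (r : seq I) (i : I) (G : I -> B) : uniq r -> i \in r ->
  (forall j, j != i -> G j = 1) -> \prod_(j <- r) G j = G i.
Proof.
move=> + ir G1; case/splitPr: ir => r1 r2.
rewrite cat_uniq /= negb_or => /and4P[_ /andP[i1 _] i2 _].
rewrite big_cat big_cons /= !big_seq !big1 ?mul1r ?mulr1 // => j jr; apply: G1.
  by apply: contraNneq i2 => <-.
by apply: contraNneq i1 => <-.
Qed.

(** Commutation is asked only between distinct indices: [F i] already stands to the left of [G i],
    and [uniq r] ensures that each [G i] is moved only past [F j] with [j != i]. *)
Lemma prodr_commM (r : seq I) (F G : I -> B) : uniq r ->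
  (forall i j, i != j -> F i * G j = G j * F i) ->
  \prod_(i <- r) (F i * G i) = (\prod_(i <- r) F i) * \prod_(i <- r) G i.
Proof.
move=> + FG; elim: r => [|i r IH]; first by rewrite !big_nil mulr1.
move=> /= /andP[ir /IH e]; rewrite !big_cons e -!mulrA; congr (_ * _).
rewrite !mulrA; congr (_ * _); rewrite big_seq.
elim/big_rec: _ => [|j y jr IHy]; first by rewrite mul1r mulr1.
rewrite mulrA -FG -?mulrA ?IHy //.
by apply: contraNneq ir => <-.
Qed.

End ProdLemmas.

Lemma dfunext (I : Type) (T : I -> Type) (f g : forall i, T i) :
  (forall i, f i = g i) -> f = g.
Proof. exact: functional_extensionality_dep. Qed.

Section Dfwith.
Context {I : eqType}.

Lemma dfwith_map (T V : I -> Type) (f : forall i, T i -> V i) u i (x : T i) :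
  (fun j => f j (dfwith u x j)) = dfwith (fun j => f j (u j)) (f i x).
Proof. by apply: dfunext => j; case: dfwithP => [|j' ij]; rewrite ?dfwith_in ?dfwith_out. Qed.

Lemma dfwith_same (T : I -> Type) (u : forall i, T i) i : dfwith u (u i) = u.
Proof. by apply: dfunext => j; case: dfwithP. Qed.

End Dfwith.

Section Multiplicative.
Local Open Scope ring_scope.
Context {C : numFieldType} {T : Type} {A B : hAlgType C}.
Variables (g : T -> A) (F : A -> B).
Hypotheses (sB : hsep B) (gT : htotal g) (FL : hlinear F).

Lemma htotal_morphM :
  (forall s t, F (g s * g t) = F (g s) * F (g t)) -> {morph F : x y / x * y}.
Proof.
move=> Fg.
have hl s : (fun y => F (g s * y)) =1 (fun y => F (g s) * F y).
  apply: htotal_eq sB gT _ _ (Fg s); last exact: hlinear_mull.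
  by apply: (hlinear_comp FL); apply: hlinear_mull (hlinear_id _).
move=> x y; move: x; apply: (htotal_eq sB gT) => [||s].
- by apply: (hlinear_comp FL); apply: hlinear_mulr (hlinear_id _).
- exact: hlinear_mulr.
- exact: hl.
Qed.

Lemma htotal_antimorphM :
  (forall s t, F (g s * g t) = F (g t) * F (g s)) -> forall x y, F (x * y) = F y * F x.
Proof.
move=> Fg.
have hl s : (fun y => F (g s * y)) =1 (fun y => F y * F (g s)).
  apply: htotal_eq sB gT _ _ (Fg s); last exact: hlinear_mulr.
  by apply: (hlinear_comp FL); apply: hlinear_mull (hlinear_id _).
move=> x y; move: x; apply: (htotal_eq sB gT) => [||s].
- by apply: (hlinear_comp FL); apply: hlinear_mulr (hlinear_id _).
- exact: hlinear_mull.
- exact: hl.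
Qed.

Lemma htotal_comm (b : B) :
  (forall t, b * F (g t) = F (g t) * b) -> forall x, b * F x = F x * b.
Proof.
by move=> bg; apply: (htotal_eq sB gT) bg; [exact: hlinear_mull|exact: hlinear_mulr].
Qed.

End Multiplicative.

Section CtensTheory.
Local Open Scope ring_scope.
Local Open Scope classical_set_scope.
Context {C : numFieldType} {I : finType}.
Implicit Types U V : I -> hAlgType C.

Lemma ctens_complete U : hcomplete (ctens U).
Proof. exact: hquot_complete free_complete. Qed.

Lemma ctens_sep U : hsep (ctens U).
Proof. by case: (ctens_complete U). Qed.

Section Pure.
Context {U : I -> hAlgType C}.
Implicit Types u v : forall i, U i.

Let pi_hom := hpi_hom (@ctens_rel C I U).

Lemma pure_one : pure (fun i => 1 : U i) = 1.
Proof.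
have := hpi_eq0 (ctens_one U); rewrite (hlinB (hom_lin pi_hom)) (hom1 pi_hom).
by move/eqP; rewrite subr_eq0 => /eqP.
Qed.

Lemma pureM u v : pure (fun i => u i * v i) = pure u * pure v.
Proof.
have := hpi_eq0 (ctens_mul u v); rewrite (hlinB (hom_lin pi_hom)) (homM pi_hom).
by move/eqP; rewrite subr_eq0 => /eqP.
Qed.

Definition multilin {B : hAlgType C} (f : (forall i, U i) -> B) :=
  forall u i, hlinear (fun a : U i => f (dfwith u a)).

Lemma pure_multilin : multilin (@pure C I U).
Proof.
move=> u i; split=> [a b|c a].
  have := hpi_eq0 (ctens_add u a b); rewrite !(hlinB (hom_lin pi_hom)).
  by move/eqP; rewrite -addrA -opprD subr_eq0 => /eqP.
have := hpi_eq0 (ctens_scal u c a).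
rewrite (hlinB (hom_lin pi_hom)) (hlinZ (hom_lin pi_hom)).
by move/eqP; rewrite subr_eq0 => /eqP.
Qed.

(** The multiplication relation collapses a word of tuples to one tuple. Density of words thus
    becomes density of pure tensors. *)
Lemma hpi_word (s : seq (tens_tuple U)) :
  hpi (@ctens_rel C I U) (word s) = pure (fun i => \prod_(t <- s) t i).
Proof.
rewrite /word (hom_prod pi_hom); elim: s => [|t s IH].
  rewrite big_nil -pure_one; congr pure; apply: dfunext => i.
  by rewrite big_nil.
rewrite big_cons IH -pureM; congr pure; apply: dfunext => i.
by rewrite big_cons.
Qed.

Lemma pure_total : htotal (@pure C I U).
Proof.
move=> Y sY cY Yp; have hT := htotal_comp (hom_lin pi_hom) (@hpi_surj _ _ _) word_total.
by apply: hT => //= s; rewrite hpi_word.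
Qed.

Section Relations.
Context {A B : hAlgType C} (f : (forall i, U i) -> B).
Variables (e : (forall i, U i) -> A) (F : A -> B).
Hypotheses (fM : multilin f) (FL : hlinear F).
Implicit Types s t p : seq (forall i, U i).

Local Notation w s := (\prod_(x <- s) e x).

Hypothesis Fw : forall s, F (w s) = f (fun i => \prod_(x <- s) x i).

Let e1 x : e x = w [:: x]. Proof. by rewrite big_seq1. Qed.

Let Fw3 s p t : F (w s * w p * w t) =
  f (fun i => (\prod_(x <- s) x i) * (\prod_(x <- p) x i) * \prod_(x <- t) x i).
Proof. by rewrite -!big_cat Fw; congr f; apply: dfunext => i; rewrite !big_cat. Qed.

Let FB a x y b : F (a * (x - y) * b) = F (a * x * b) - F (a * y * b).
Proof. by rewrite mulrBr mulrBl (hlinB FL). Qed.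

(** Surrounding words multiply slot [i] on both sides and leave a tuple of the same shape, so
    multilinearity of [f] in slot [i] still applies. *)
Let Fd s t u i (z : U i) : F (w s * e (dfwith u z) * w t) =
  f (dfwith (fun j => (\prod_(x <- s) x j) * u j * \prod_(x <- t) x j)
            ((\prod_(x <- s) x i) * z * \prod_(x <- t) x i)).
Proof.
rewrite e1 Fw3.
rewrite -(dfwith_map (fun j z => (\prod_(x <- s) x j) * z * \prod_(x <- t) x j)).
by congr f; apply: dfunext => j; rewrite big_seq1.
Qed.

(** Here and in the next three lemmas, a defining relation is placed between two words. [F] sees
    only the componentwise product, on which both sides of the relation agree; multilinearity of [f]
    enters for the additive and scalar relations. *)
Lemma ctens_one_kill s t : F (w s * (e (fun=> 1) - 1) * w t) = 0.
Proof.
apply/eqP; rewrite FB subr_eq0 mulr1 -big_cat Fw e1 Fw3; apply/eqP.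
by congr f; apply: dfunext => i; rewrite big_seq1 mulr1 big_cat.
Qed.

Lemma ctens_mul_kill s t u v :
  F (w s * (e (fun i => u i * v i) - e u * e v) * w t) = 0.
Proof.
apply/eqP; rewrite FB subr_eq0 (e1 u) (e1 v) (e1 (fun i => u i * v i)).
rewrite -[w [:: u] * w [:: v]]big_cat !Fw3; apply/eqP.
by congr f; apply: dfunext => i; rewrite big_cat !big_seq1.
Qed.

Lemma ctens_add_kill s t u i (a b : U i) :
  F (w s * (e (dfwith u (a + b)) - e (dfwith u a) - e (dfwith u b)) * w t) = 0.
Proof.
apply/eqP; rewrite !FB !Fd mulrDr mulrDl (hlinD (fM _ _)).
by rewrite addrAC addrK subrr.
Qed.

Lemma ctens_scal_kill s t u i (c : fps C) (a : U i) :
  F (w s * (e (dfwith u (hscal c * a)) - hscal c * e (dfwith u a)) * w t) = 0.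
Proof.
apply/eqP; rewrite FB hscalCA -[hscal c * _ * _]mulrA (hlinZ FL) !Fd.
by rewrite hscalCA -[hscal c * _ * _]mulrA (hlinZ (fM _ _)) subrr.
Qed.

End Relations.

Section Lift.
Context {B : hAlgType C} (f : (forall i, U i) -> B).

(** The universal property for multilinear [f]. As [f] need not be multiplicative, it cannot be
    extended as an algebra map from the generators; instead a word of tuples is sent to [f] of its
    componentwise product, and the result is shown to descend to the quotient. *)
Definition mlift : ctens U -> B := locked (hquot_lift
  (word_lift (fun s : seq (tens_tuple U) => f (fun i => \prod_(t <- s) t i)))).

Hypotheses (cB : hcomplete B) (fM : multilin f).

Lemma ctens_rel_kill (F : free_halg C (tens_tuple U) -> B) a x b : hlinear F ->
  (forall s, F (word s) = f (fun i => \prod_(t <- s) t i)) ->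
  ctens_rel x -> F (a * x * b) = 0.
Proof.
move=> FL Fw rx; have [sB _] := cB.
have Fwxw (s t : seq (tens_tuple U)) : F (word s * x * word t) = 0.
  case: rx => [|u v|u i p q|u i c p].
  - exact: (ctens_one_kill FL Fw).
  - exact: (ctens_mul_kill FL Fw).
  - exact: (ctens_add_kill fM FL Fw).
  - exact: (ctens_scal_kill fM FL Fw).
have Fs s : (fun y => F (word s * x * y)) =1 (fun=> 0).
  apply: (htotal_eq sB word_total) (Fwxw s); last exact: hlinear0.
  by apply: (hlinear_comp FL); apply: hlinear_mull (hlinear_id _).
move: a; apply: (htotal_eq sB word_total) (Fs^~ b); last exact: hlinear0.
apply: (hlinear_comp FL); apply: hlinear_mulr; exact: hlinear_mulr (hlinear_id _).
Qed.

Let F_rel a x b : ctens_rel x ->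
  word_lift (fun s : seq (tens_tuple U) => f (fun i => \prod_(t <- s) t i)) (a * x * b) = 0.
Proof. by apply: ctens_rel_kill => [|s]; [exact: word_lift_lin|exact: word_lift_word]. Qed.

Lemma mlift_lin : hlinear mlift.
Proof.
rewrite /mlift -lock; have [sB _] := cB.
by apply: hquot_lift_lin; [|exact: word_lift_lin|exact: F_rel].
Qed.

Lemma mliftE u : mlift (pure u) = f u.
Proof.
have [sB _] := cB; rewrite /mlift -lock /pure hquot_liftE //; last exact: word_lift_lin.
by rewrite -word1 word_lift_word //; congr f; apply: dfunext => i; rewrite big_seq1.
Qed.

End Lift.

Lemma multilin_prod {B : hAlgType C} (f : forall i, U i -> B) :
  (forall i, hlinear (f i)) -> multilin (fun u => \prod_i f i (u i)).
Proof.
move=> fL u i.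
have : uniq (index_enum I) by exact: index_enum_uniq.
have : i \in index_enum I by exact: mem_index_enum.
case/splitPr => r1 r2; rewrite cat_uniq /= negb_or => /and4P[_ /andP[i1 _] i2 _].
have e r (a : U i) : i \notin r ->
    \prod_(j <- r) f j (dfwith u a j) = \prod_(j <- r) f j (u j).
  move=> ir; apply: eq_big_seq => j jr; rewrite dfwith_out //.
  by apply: contraNneq ir => ->.
rewrite (_ : (fun a => _) = fun a => (\prod_(j <- r1) f j (u j)) *
    (f i a * \prod_(j <- r2) f j (u j))); last first.
  by apply/funext => a; rewrite big_cat big_cons /= !e // dfwith_in.
by apply: hlinear_mull; exact: hlinear_mulr.
Qed.

Definition inj (i : I) (a : U i) : ctens U := pure (dfwith (fun j => 1 : U j) a).

Lemma inj_hom i : halg_hom (@inj i).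
Proof.
split=> [||a b]; first exact: pure_multilin.
  rewrite /inj (dfwith_same (fun j => 1 : U j)); exact: pure_one.
rewrite /inj -pureM; congr pure; apply: dfunext => j.
by case: dfwithP => [|j' ij]; rewrite ?dfwith_in // !dfwith_out // mulr1.
Qed.

Lemma inj_comm i j (a : U i) (b : U j) : i != j -> inj a * inj b = inj b * inj a.
Proof.
move=> ij; rewrite /inj -!pureM; congr pure; apply: dfunext => k.
have [<-|ik] := eqVneq i k; first by rewrite [dfwith _ b i]dfwith_out 1?eq_sym // mulr1 mul1r.
by rewrite [dfwith _ a k]dfwith_out // mulr1 mul1r.
Qed.

(** The embedded factors thus generate a dense subalgebra, and algebra maps out of the tensor
    product may be compared on them. *)
Lemma pureE u : pure u = \prod_i inj (u i).
Proof.
have e r : uniq r -> \prod_(i <- r) inj (u i) =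
    pure (fun i => if i \in r then u i else 1).
  elim: r => [|i r IH]; first by rewrite big_nil pure_one.
  move=> /= /andP[ir /IH e]; rewrite big_cons e /inj -pureM; congr pure.
  apply: dfunext => j; rewrite inE; case: dfwithP => [|k ik].
    by rewrite (negPf ir) mulr1 eqxx.
  by rewrite mul1r eq_sym (negPf ik).
rewrite e; last exact: index_enum_uniq.
by congr pure; apply: dfunext => i; rewrite mem_index_enum.
Qed.

Lemma ctens_hom_eq {B : hAlgType C} (F G : ctens U -> B) : hsep B ->
  halg_hom F -> halg_hom G -> (forall i (a : U i), F (inj a) = G (inj a)) -> F =1 G.
Proof.
move=> sB FH GH e; apply: (htotal_eq sB pure_total) => [||u].
- exact: hom_lin.
- exact: hom_lin.
- by rewrite pureE (hom_prod FH) (hom_prod GH); apply: eq_bigr.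
Qed.

Section CommLift.
Context {B : hAlgType C} (f : forall i, U i -> B).

Definition clift : ctens U -> B := mlift (fun u => \prod_i f (u i)).

Hypotheses (cB : hcomplete B) (fH : forall i, halg_hom (@f i)).
Hypothesis fC : forall i j (a : U i) (b : U j), i != j -> f a * f b = f b * f a.

Let fM : multilin (fun u => \prod_i f (u i)).
Proof. by apply: multilin_prod => i; exact: hom_lin. Qed.

Lemma cliftE u : clift (pure u) = \prod_i f (u i).
Proof. exact: (mliftE cB fM). Qed.

(** On pure tensors, commutation of different images regroups $\prod_i f(u_i)f(v_i)$ as a product of
    two products; density does the rest. *)
Lemma clift_hom : halg_hom clift.
Proof.
have [sB _] := cB; have L : hlinear clift := mlift_lin cB fM.
split=> //.
  by rewrite -pure_one cliftE big1 // => i _; exact: hom1.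
apply: (htotal_morphM sB pure_total L) => u v.
rewrite -pureM !cliftE -prodr_commM ?index_enum_uniq //; last first.
  by move=> i j; exact: fC.
by apply: eq_bigr => i _; exact: homM.
Qed.

Lemma clift_inj i (a : U i) : clift (inj a) = f a.
Proof.
rewrite cliftE (@prodr_only1 _ _ _ i) ?index_enum_uniq ?mem_index_enum ?dfwith_in // => j ji.
by rewrite dfwith_out 1?eq_sym //; exact: hom1.
Qed.

End CommLift.

End Pure.

Section Map.
Context {U V : I -> hAlgType C} (f : forall i, U i -> V i).

Lemma multilin_map : (forall i, hlinear (@f i)) ->
  multilin (fun u : forall i, U i => pure (fun i => f (u i))).
Proof.
move=> fL u i; rewrite (_ : (fun a => _) =
    (fun a => pure (dfwith (fun j => f (u j)) a)) \o @f i).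
  by apply: hlinear_comp (fL i); exact: pure_multilin.
by apply/funext => a /=; rewrite -(dfwith_map f).
Qed.

(** Built on [mlift] so that it also applies to factorwise maps that are only linear, such as
    antipodes and slices. *)
Definition cmap : ctens U -> ctens V := mlift (fun u : forall i, U i => pure (fun i => f (u i))).

Lemma cmapE u : (forall i, hlinear (@f i)) -> cmap (pure u) = pure (fun i => f (u i)).
Proof. by move=> fL; exact: mliftE (ctens_complete V) (multilin_map fL) u. Qed.

Lemma cmap_lin : (forall i, hlinear (@f i)) -> hlinear cmap.
Proof. by move=> fL; exact: mlift_lin (ctens_complete V) (multilin_map fL). Qed.

Lemma cmap_hom : (forall i, halg_hom (@f i)) -> halg_hom cmap.
Proof.
move=> fH; have fL i := hom_lin (fH i); have L := cmap_lin fL.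
split=> //.
  by rewrite -pure_one cmapE // -pure_one; congr pure; apply: dfunext => i; exact: hom1.
apply: (htotal_morphM (@ctens_sep V) pure_total L) => u v.
rewrite -pureM !cmapE // -pureM; congr pure; apply: dfunext => i; exact: homM.
Qed.

End Map.

(** The slots are freed one at a time: with the others fixed, a pure tensor is linear, hence
    continuous, in one slot, where density of that single family applies. *)
Lemma pure_family_total (T : I -> Type) U (g : forall i, T i -> U i) :
  (forall i, htotal (@g i)) -> htotal (fun t : forall i, T i => pure (fun i => g i (t i))).
Proof.
move=> gT Y sY cY Yg.
(* The list [r] holds the slots whose entry is arbitrary; all other entries come from the given
   families. *)
suff Yr (r : seq I) u : (forall i, i \notin r -> exists t, g i t = u i) -> Y (pure u).
  by apply: pure_total => // u; apply: (Yr (enum I)) => i; rewrite mem_enum.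
elim: r u => [|i r IH] u ug.
  have ug' i : {t | g i t = u i} by apply: cid; exact: ug.
  have := Yg (fun i => sval (ug' i)); congr Y; congr pure.
  by apply: dfunext => i; exact: (svalP (ug' i)).
rewrite -(dfwith_same u i); move: (u i).
apply: (gT i [set a | Y (pure (dfwith u a))]) => [||t].
- exact: (hsubmod_preim (@pure_multilin U u i) sY).
- exact: (hclosed_preim (@pure_multilin U u i) cY).
- apply: IH => j; case: dfwithP => [_|k ik kr]; first by exists t.
  by apply: ug; rewrite inE negb_or eq_sym ik.
Qed.

End CtensTheory.

(** * Tensor squares and cubes *)

Lemma mulrACA_comm (A : pzRingType) (x y z t : A) :
  (y * z = z * y -> x * y * (z * t) = x * z * (y * t))%R.
Proof. by move=> e; rewrite -!mulrA; congr (_ * _)%R; rewrite !mulrA e. Qed.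

Section Ctens2.
Local Open Scope ring_scope.
Local Open Scope classical_set_scope.
Context {C : numFieldType}.
Implicit Types U V B : hAlgType C.

Lemma ord2P (P : 'I_2 -> Prop) : P 0 -> P 1 -> forall i, P i.
Proof.
move=> P0 P1 [[|[|//]] h].
  by rewrite (_ : Ordinal h = 0) //; exact: val_inj.
by rewrite (_ : Ordinal h = 1) //; exact: val_inj.
Qed.

Lemma ord3P (P : 'I_3 -> Prop) : P 0 -> P 1 -> P 2 -> forall i, P i.
Proof.
move=> P0 P1 P2 [[|[|[|//]]] h].
- by rewrite (_ : Ordinal h = 0) //; exact: val_inj.
- by rewrite (_ : Ordinal h = 1) //; exact: val_inj.
- by rewrite (_ : Ordinal h = 2) //; exact: val_inj.
Qed.

Definition pair2 {U} (ab : U * U) : ctens2 U := pure2 ab.1 ab.2.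

Lemma pure_pure2 U (u : 'I_2 -> U) : pure (U := fun=> U) u = pure2 (u 0) (u 1).
Proof. by congr pure; apply: funext; apply: ord2P. Qed.

Lemma ctens2_complete U : hcomplete (ctens2 U).
Proof. exact: ctens_complete. Qed.

Lemma ctens3_complete U : hcomplete (ctens3 U).
Proof. exact: ctens_complete. Qed.

Lemma pair2_total U : htotal (@pair2 U).
Proof.
move=> Y sY cY Yp; apply: (@pure_total _ _ (fun _ : 'I_2 => U)) => // u.
by rewrite pure_pure2; exact: (Yp (u 0, u 1)).
Qed.

Lemma pure_pure3 U (u : 'I_3 -> U) : pure (U := fun=> U) u = pure3 (u 0) (u 1) (u 2).
Proof. by congr pure; apply: funext; apply: ord3P. Qed.

Lemma pure3_total U : htotal (fun abc : U * U * U => pure3 abc.1.1 abc.1.2 abc.2).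
Proof.
move=> Y sY cY Yp; apply: (@pure_total _ _ (fun _ : 'I_3 => U)) => // u.
by rewrite pure_pure3; exact: (Yp (u 0, u 1, u 2)).
Qed.

Definition bilin {U B} (f : U * U -> B) :=
  (forall b, hlinear (fun a => f (a, b))) /\ (forall a, hlinear (fun b => f (a, b))).

Lemma bilin_hscalr U (t : U -> fps C) : hlinear t ->
  bilin (fun ab : U * U => hscal (t ab.2) * ab.1).
Proof.
move=> tL; split=> [b|a] /=; last exact: hlinear_hscal tL.
exact: hlinear_mull (hlinear_id U).
Qed.

Lemma bilin_hscall U (t : U -> fps C) : hlinear t ->
  bilin (fun ab : U * U => hscal (t ab.1) * ab.2).
Proof.
move=> tL; split=> [b|a] /=; first exact: hlinear_hscal tL.
exact: hlinear_mull (hlinear_id U).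
Qed.

Section Bilin.
Context {U B : hAlgType C} (f : U * U -> B).
Hypotheses (cB : hcomplete B) (fB : bilin f).

Let f2 (u : 'I_2 -> U) := f (u 0, u 1).

Let f2_multilin : multilin (U := fun=> U) f2.
Proof.
move=> u; apply: ord2P.
  rewrite (_ : (fun a => _) = fun a => f (a, u 1)); first exact: (proj1 fB).
  by apply: funext => a; rewrite /f2 dfwith_in dfwith_out.
rewrite (_ : (fun a => _) = fun a => f (u 0, a)); first exact: (proj2 fB).
by apply: funext => a; rewrite /f2 dfwith_in dfwith_out.
Qed.

(** [mlift] supplies the existence that the choice in [linext] requires; every map defined by
    [linext] on a tensor square is computed through this equality. *)
Let linext2_mlift : linext pair2 f = mlift (U := fun=> U) f2.
Proof.
have [sB _] := cB; apply: (linextE sB (@pair2_total U)); first exact: mlift_lin.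
by move=> [a b]; exact: (mliftE cB f2_multilin).
Qed.

Lemma linext2_lin : hlinear (linext pair2 f).
Proof. by rewrite linext2_mlift; exact: mlift_lin. Qed.

Lemma linext2E a b : linext pair2 f (pure2 a b) = f (a, b).
Proof. by rewrite linext2_mlift; exact: (mliftE cB f2_multilin). Qed.

End Bilin.

Section Pure2.
Context {U : hAlgType C}.

Lemma pure2_one : pure2 1 1 = 1 :> ctens2 U.
Proof.
rewrite -[RHS]pure_one; congr pure; apply: funext; exact: ord2P.
Qed.

Lemma pure2M (a b a' b' : U) : pure2 (a * a') (b * b') = pure2 a b * pure2 a' b'.
Proof. by rewrite -[RHS]pureM; congr pure; apply: funext; exact: ord2P. Qed.

Lemma pure2_bilin : bilin (@pair2 U).
Proof.
split=> [b|a].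
  have := @pure_multilin _ _ (fun _ : 'I_2 => U) (fun=> b) 0.
  congr hlinear; apply: funext => a; rewrite pure_pure2.
  by rewrite dfwith_in dfwith_out.
have := @pure_multilin _ _ (fun _ : 'I_2 => U) (fun=> a) 1.
congr hlinear; apply: funext => b; rewrite pure_pure2.
by rewrite dfwith_in dfwith_out.
Qed.

Definition pure2_linl b : hlinear (fun a : U => pure2 a b) := proj1 pure2_bilin b.
Definition pure2_linr a : hlinear (fun b : U => pure2 a b) := proj2 pure2_bilin a.

Lemma pure2_prod I (r : seq I) (P : pred I) (a b : I -> U) :
  \prod_(i <- r | P i) pure2 (a i) (b i) =
  pure2 (\prod_(i <- r | P i) a i) (\prod_(i <- r | P i) b i).
Proof.
elim/big_rec3: _ => [|i x y z _ ->]; first by rewrite pure2_one.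
by rewrite pure2M.
Qed.

Definition t3 (a b c : U) (k : 'I_3) := if k == 0 then a else if k == 1 then b else c.

Lemma pure3_one : pure3 1 1 1 = 1 :> ctens3 U.
Proof. by rewrite -[RHS]pure_one; congr pure; apply: funext; exact: ord3P. Qed.

Lemma pure3M (a b c a' b' c' : U) :
  pure3 (a * a') (b * b') (c * c') = pure3 a b c * pure3 a' b' c'.
Proof. by rewrite -[RHS]pureM; congr pure; apply: funext; exact: ord3P. Qed.

Lemma pure3_lin1 b c : hlinear (fun a : U => pure3 a b c).
Proof.
have := @pure_multilin _ _ (fun _ : 'I_3 => U) (t3 0 b c) 0.
congr hlinear; apply: funext => a; congr pure; apply: funext.
by apply: ord3P; rewrite ?dfwith_in ?dfwith_out.
Qed.

Lemma pure3_lin2 a c : hlinear (fun b : U => pure3 a b c).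
Proof.
have := @pure_multilin _ _ (fun _ : 'I_3 => U) (t3 a 0 c) 1.
congr hlinear; apply: funext => b; congr pure; apply: funext.
by apply: ord3P; rewrite ?dfwith_in ?dfwith_out.
Qed.

Lemma pure3_lin3 a b : hlinear (fun c : U => pure3 a b c).
Proof.
have := @pure_multilin _ _ (fun _ : 'I_3 => U) (t3 a b 0) 2.
congr hlinear; apply: funext => c; congr pure; apply: funext.
by apply: ord3P; rewrite ?dfwith_in ?dfwith_out.
Qed.

End Pure2.

Section Bilin_hom.
Context {U B : hAlgType C} (f : U * U -> B).
Hypotheses (cB : hcomplete B) (fB : bilin f) (f1 : f (1, 1) = 1).

Lemma linext2_hom :
  (forall a b a' b', f (a * a', b * b') = f (a, b) * f (a', b')) ->
  halg_hom (linext pair2 f).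
Proof.
move=> fM; have L := linext2_lin cB fB; have [sB _] := cB.
split=> //; first by rewrite -pure2_one (linext2E cB fB).
apply: (htotal_morphM sB (@pair2_total U) L) => -[a b] [a' b'].
by rewrite -pure2M !(linext2E cB fB) fM.
Qed.

End Bilin_hom.

Section Legs.
Context {U : hAlgType C}.

Let flip_bilin : bilin (fun ab : U * U => pure2 ab.2 ab.1).
Proof. by split=> [b|a]; [exact: pure2_linr|exact: pure2_linl]. Qed.

Lemma flipE (a b : U) : flip (pure2 a b) = pure2 b a.
Proof. exact: (linext2E (@ctens2_complete U) flip_bilin). Qed.

Lemma flip_hom : halg_hom (@flip C U).
Proof.
apply: (linext2_hom (@ctens2_complete U) flip_bilin) => [|a b a' b'] /=.
  exact: pure2_one.
exact: pure2M.
Qed.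

Let leg12_bilin : bilin (fun ab : U * U => pure3 ab.1 ab.2 1).
Proof. by split=> [b|a]; [exact: pure3_lin1|exact: pure3_lin2]. Qed.

Lemma leg12E (a b : U) : leg12 (pure2 a b) = pure3 a b 1.
Proof. exact: (linext2E (@ctens3_complete U) leg12_bilin). Qed.

Lemma leg12_hom : halg_hom (@leg12 C U).
Proof.
apply: (linext2_hom (@ctens3_complete U) leg12_bilin) => [|a b a' b'] /=.
  exact: pure3_one.
by rewrite -pure3M mulr1.
Qed.

Let leg13_bilin : bilin (fun ab : U * U => pure3 ab.1 1 ab.2).
Proof. by split=> [b|a]; [exact: pure3_lin1|exact: pure3_lin3]. Qed.

Lemma leg13E (a b : U) : leg13 (pure2 a b) = pure3 a 1 b.
Proof. exact: (linext2E (@ctens3_complete U) leg13_bilin). Qed.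

Lemma leg13_hom : halg_hom (@leg13 C U).
Proof.
apply: (linext2_hom (@ctens3_complete U) leg13_bilin) => [|a b a' b'] /=.
  exact: pure3_one.
by rewrite -pure3M mulr1.
Qed.

Let leg23_bilin : bilin (fun ab : U * U => pure3 1 ab.1 ab.2).
Proof. by split=> [b|a]; [exact: pure3_lin2|exact: pure3_lin3]. Qed.

Lemma leg23E (a b : U) : leg23 (pure2 a b) = pure3 1 a b.
Proof. exact: (linext2E (@ctens3_complete U) leg23_bilin). Qed.

Lemma leg23_hom : halg_hom (@leg23 C U).
Proof.
apply: (linext2_hom (@ctens3_complete U) leg23_bilin) => [|a b a' b'] /=.
  exact: pure3_one.
by rewrite -pure3M mulr1.
Qed.

(** Elements on disjoint legs commute, which is what makes $\Delta\otimes\mathrm{id}$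
    multiplicative. *)
Lemma leg12_pure3_comm (x : ctens2 U) c : pure3 1 1 c * leg12 x = leg12 x * pure3 1 1 c.
Proof.
move: x; have [s3 _] := @ctens3_complete U.
apply: (htotal_comm s3 (@pair2_total U) (hom_lin leg12_hom)) => -[a b].
by rewrite leg12E -!pure3M !mul1r !mulr1.
Qed.

Lemma leg23_pure3_comm (x : ctens2 U) c : pure3 c 1 1 * leg23 x = leg23 x * pure3 c 1 1.
Proof.
move: x; have [s3 _] := @ctens3_complete U.
apply: (htotal_comm s3 (@pair2_total U) (hom_lin leg23_hom)) => -[a b].
by rewrite leg23E -!pure3M !mul1r !mulr1.
Qed.

Section Coproduct.
Context {D : U -> ctens2 U} (DH : halg_hom D).

Let tens_l_bilin : bilin (fun ab : U * U => leg12 (D ab.1) * pure3 1 1 ab.2).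
Proof.
split=> [b|a] /=; last by apply: hlinear_mull; exact: pure3_lin3.
by apply: hlinear_mulr; exact: hlinear_comp (hom_lin leg12_hom) (hom_lin DH).
Qed.

Lemma tens_lE (a b : U) : tens_l D (pure2 a b) = leg12 (D a) * pure3 1 1 b.
Proof. exact: (linext2E (@ctens3_complete U) tens_l_bilin). Qed.

Lemma tens_l_hom : halg_hom (tens_l D).
Proof.
apply: (linext2_hom (@ctens3_complete U) tens_l_bilin) => [|a b a' b'] /=.
  by rewrite pure3_one mulr1 (hom1 DH) (hom1 leg12_hom).
rewrite (homM DH) (homM leg12_hom).
have -> : pure3 1 1 (b * b') = pure3 1 1 b * pure3 1 1 b' by rewrite -pure3M !mulr1.
by apply: mulrACA_comm; rewrite leg12_pure3_comm.
Qed.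

Let tens_r_bilin : bilin (fun ab : U * U => pure3 ab.1 1 1 * leg23 (D ab.2)).
Proof.
split=> [b|a] /=; first by apply: hlinear_mulr; exact: pure3_lin1.
by apply: hlinear_mull; exact: hlinear_comp (hom_lin leg23_hom) (hom_lin DH).
Qed.

Lemma tens_rE (a b : U) : tens_r D (pure2 a b) = pure3 a 1 1 * leg23 (D b).
Proof. exact: (linext2E (@ctens3_complete U) tens_r_bilin). Qed.

Lemma tens_r_hom : halg_hom (tens_r D).
Proof.
apply: (linext2_hom (@ctens3_complete U) tens_r_bilin) => [|a b a' b'] /=.
  by rewrite pure3_one mul1r (hom1 DH) (hom1 leg23_hom).
rewrite (homM DH) (homM leg23_hom).
have -> : pure3 (a * a') 1 1 = pure3 a 1 1 * pure3 a' 1 1 by rewrite -pure3M !mulr1.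
by apply: mulrACA_comm; exact: leg23_pure3_comm.
Qed.

End Coproduct.
End Legs.

Definition tens_map3 {U V} (f : U -> V) : ctens3 U -> ctens3 V :=
  cmap (fun _ : 'I_3 => f).

Section TensMap.
Context {U V : hAlgType C} {f : U -> V}.
Hypothesis fH : halg_hom f.

Let tens_map_bilin : bilin (fun ab : U * U => pure2 (f ab.1) (f ab.2)).
Proof.
have fL := hom_lin fH; split=> [b|a].
  exact: (hlinear_comp (pure2_linl (f b)) fL).
exact: (hlinear_comp (pure2_linr (f a)) fL).
Qed.

Lemma tens_mapE a b : tens_map f (pure2 a b) = pure2 (f a) (f b).
Proof. exact: (linext2E (@ctens2_complete V) tens_map_bilin). Qed.

Lemma tens_map_pure2Z c a b :
  tens_map f (hscal c * pure2 a b) = hscal c * pure2 (f a) (f b).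
Proof.
rewrite -tens_mapE.
exact: hlinZ (linext2_lin (@ctens2_complete V) tens_map_bilin) _ _.
Qed.

Lemma tens_map_pure2D a b c d a' b' c' d' :
  f a = a' -> f b = b' -> f c = c' -> f d = d' ->
  tens_map f (pure2 a b + pure2 c d) = pure2 a' b' + pure2 c' d'.
Proof.
move=> <- <- <- <-; rewrite -!tens_mapE.
exact: hlinD (linext2_lin (@ctens2_complete V) tens_map_bilin) _ _.
Qed.

Lemma tens_map_hom : halg_hom (tens_map f).
Proof.
apply: (linext2_hom (@ctens2_complete V) tens_map_bilin) => [|a b a' b'] /=.
  by rewrite (hom1 fH) pure2_one.
by rewrite !(homM fH) pure2M.
Qed.

Lemma tens_map3_hom : halg_hom (tens_map3 f).
Proof. by apply: cmap_hom. Qed.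

Lemma tens_map3E a b c : tens_map3 f (pure3 a b c) = pure3 (f a) (f b) (f c).
Proof.
have fL := hom_lin fH; rewrite [LHS]cmapE //; congr pure; apply: funext.
by apply: ord3P.
Qed.

End TensMap.

End Ctens2.

(** * Gluing along commuting homomorphisms *)

Section ClosedSpan.
Local Open Scope ring_scope.
Local Open Scope classical_set_scope.
Context {C : numFieldType} {A B : hAlgType C}.

Lemma closed_span_min (f : A -> B) (X : set A) (Y : set B) : hlinear f ->
  hsubmod Y -> hclosed Y -> (forall x, X x -> Y (f x)) ->
  forall x, closed_span X x -> Y (f x).
Proof.
move=> fL sY cY fX x /(_ (f @^-1` Y)); apply; split=> //.
by split; [exact: hsubmod_preim|exact: hclosed_preim].
Qed.

Lemma closed_span_map (f : A -> B) (X : set A) (Y : set B) : hlinear f ->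
  (forall x, X x -> Y (f x)) -> forall x, closed_span X x -> closed_span Y (f x).
Proof.
move=> fL fX; have [sY cY] := closed_spanP Y.
by apply: (closed_span_min fL) => // x /fX; exact: closed_span_sub.
Qed.

(** Used for the factors $1+\Theta_i$ of the R-matrices: expanding their product, every term other
    than 1 is a product of elements of [Y]. *)
Lemma prod1D_mul_closed I (r : seq I) (Y : set A) (t : I -> A) : hsubmod Y ->
  (forall x y, Y x -> Y y -> Y (x * y)) -> (forall i, Y (t i)) ->
  exists2 y, Y y & \prod_(i <- r) (1 + t i) = 1 + y.
Proof.
move=> [Y0 YD _] YM Yt; elim: r => [|i r [y Yy e]].
  by exists 0; rewrite ?big_nil ?addr0.
exists (y + (t i + t i * y)); first by do 2!apply: (YD) => //; exact: YM.
by rewrite big_cons e mulrDl mul1r mulrDr mulr1 -addrA.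
Qed.

End ClosedSpan.

Lemma closed_span_mul {C : numFieldType} {A : hAlgType C} (X : set A) :
  (forall x y, X x -> X y -> X (x * y)%R) ->
  forall x y, closed_span X x -> closed_span X y -> closed_span X (x * y)%R.
Proof.
move=> XM; have [sX cX] := closed_spanP X.
have XL x y : X x -> closed_span X y -> closed_span X (x * y)%R.
  by move=> Xx; apply: (closed_span_map (hlinear_mull x (hlinear_id A))) => z; exact: XM.
move=> x y cx cy; move: x cx.
apply: (closed_span_min (hlinear_mulr y (hlinear_id A)) sX cX) => x Xx; exact: XL.
Qed.

(** * Naturality of flip, legs and coproducts under algebra homomorphisms *)

Section LegNaturality.
Local Open Scope ring_scope.
Context {C : numFieldType} {U V : hAlgType C} {f : U -> V}.
Hypothesis fH : halg_hom f.

Let s3 : hsep (ctens3 V). Proof. by case: (@ctens3_complete _ V). Qed.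
Let s2 : hsep (ctens2 V). Proof. by case: (@ctens2_complete _ V). Qed.

Lemma flip_map x : flip (tens_map f x) = tens_map f (flip x).
Proof.
move: x; apply: (htotal_eq s2 (@pair2_total _ U)) => [||[a b]].
- exact: hlinear_comp (hom_lin flip_hom) (hom_lin (tens_map_hom fH)).
- exact: hlinear_comp (hom_lin (tens_map_hom fH)) (hom_lin flip_hom).
- by rewrite /pair2 flipE !(tens_mapE fH) flipE.
Qed.

Lemma leg12_map x : leg12 (tens_map f x) = tens_map3 f (leg12 x).
Proof.
move: x; apply: (htotal_eq s3 (@pair2_total _ U)) => [||[a b]].
- exact: hlinear_comp (hom_lin leg12_hom) (hom_lin (tens_map_hom fH)).
- exact: hlinear_comp (hom_lin (tens_map3_hom fH)) (hom_lin leg12_hom).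
- by rewrite /pair2 leg12E (tens_mapE fH) (tens_map3E fH) leg12E (hom1 fH).
Qed.

Lemma leg13_map x : leg13 (tens_map f x) = tens_map3 f (leg13 x).
Proof.
move: x; apply: (htotal_eq s3 (@pair2_total _ U)) => [||[a b]].
- exact: hlinear_comp (hom_lin leg13_hom) (hom_lin (tens_map_hom fH)).
- exact: hlinear_comp (hom_lin (tens_map3_hom fH)) (hom_lin leg13_hom).
- by rewrite /pair2 leg13E (tens_mapE fH) (tens_map3E fH) leg13E (hom1 fH).
Qed.

Lemma leg23_map x : leg23 (tens_map f x) = tens_map3 f (leg23 x).
Proof.
move: x; apply: (htotal_eq s3 (@pair2_total _ U)) => [||[a b]].
- exact: hlinear_comp (hom_lin leg23_hom) (hom_lin (tens_map_hom fH)).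
- exact: hlinear_comp (hom_lin (tens_map3_hom fH)) (hom_lin leg23_hom).
- by rewrite /pair2 leg23E (tens_mapE fH) (tens_map3E fH) leg23E (hom1 fH).
Qed.

Context {DU : U -> ctens2 U} {DV : V -> ctens2 V}.
Hypotheses (DUH : halg_hom DU) (DVH : halg_hom DV).
Hypothesis fD : forall a, DV (f a) = tens_map f (DU a).

Lemma tens_l_map x : tens_l DV (tens_map f x) = tens_map3 f (tens_l DU x).
Proof.
move: x; apply: (htotal_eq s3 (@pair2_total _ U)) => [||[a b]].
- exact: hlinear_comp (hom_lin (tens_l_hom DVH)) (hom_lin (tens_map_hom fH)).
- exact: hlinear_comp (hom_lin (tens_map3_hom fH)) (hom_lin (tens_l_hom DUH)).
rewrite /pair2 (tens_lE DUH) (tens_mapE fH) (tens_lE DVH) (homM (tens_map3_hom fH)).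
by rewrite (tens_map3E fH) fD leg12_map (hom1 fH).
Qed.

Lemma tens_r_map x : tens_r DV (tens_map f x) = tens_map3 f (tens_r DU x).
Proof.
move: x; apply: (htotal_eq s3 (@pair2_total _ U)) => [||[a b]].
- exact: hlinear_comp (hom_lin (tens_r_hom DVH)) (hom_lin (tens_map_hom fH)).
- exact: hlinear_comp (hom_lin (tens_map3_hom fH)) (hom_lin (tens_r_hom DUH)).
rewrite /pair2 (tens_rE DUH) (tens_mapE fH) (tens_rE DVH) (homM (tens_map3_hom fH)).
by rewrite (tens_map3E fH) fD leg23_map (hom1 fH).
Qed.

End LegNaturality.

Section CommutingImages.
Local Open Scope ring_scope.
Context {C : numFieldType} {U V W : hAlgType C} {f : U -> W} {g : V -> W}.
Hypotheses (fH : halg_hom f) (gH : halg_hom g).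
Hypothesis fg : forall a b, f a * g b = g b * f a.

Lemma tens_map_comm x y :
  tens_map f x * tens_map g y = tens_map g y * tens_map f x.
Proof.
have s2 : hsep (ctens2 W) by case: (@ctens2_complete _ W).
have fL := hom_lin (tens_map_hom fH); have gL := hom_lin (tens_map_hom gH).
move: y; apply: (htotal_comm s2 (@pair2_total _ V) gL) => -[a' b'].
apply/esym; move: x; apply: (htotal_comm s2 (@pair2_total _ U) fL) => -[a b].
by rewrite /pair2 (tens_mapE fH) (tens_mapE gH) -!pure2M !fg.
Qed.

Let t3f := hom_lin (tens_map3_hom fH).
Let t3g := hom_lin (tens_map3_hom gH).

Lemma tens_map3_comm x y :
  tens_map3 f x * tens_map3 g y = tens_map3 g y * tens_map3 f x.
Proof.
have s3 : hsep (ctens3 W) by case: (@ctens3_complete _ W).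
move: y; apply: (htotal_comm s3 (@pure3_total _ V) t3g) => -[[a' b'] c'].
apply/esym; move: x; apply: (htotal_comm s3 (@pure3_total _ U) t3f) => -[[a b] c].
by rewrite (tens_map3E fH) (tens_map3E gH) -!pure3M !fg.
Qed.

End CommutingImages.

(** * Transport of structure between an algebra [W] and the tensor product of its commuting parts *)

Section TensorSum.
Local Open Scope ring_scope.
Local Open Scope classical_set_scope.
Context {C : numFieldType} {I : finType} {U : I -> hAlgType C} {W : hAlgType C}.
Context (iota : forall i, U i -> W) (phi : W -> ctens U).
Hypotheses (cW : hcomplete W) (iotaH : forall i, halg_hom (@iota i)).
Hypothesis iotaC : forall i j (a : U i) (b : U j), i != j -> iota a * iota b = iota b * iota a.
Hypotheses (phiH : halg_hom phi) (phi_iota : forall i (a : U i), phi (iota a) = inj a).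

(** The inverse of [phi]: the hypothesis [csumK] gives one composite, and [phiK] gives the other by
    checking embedded factors. *)
Definition csum : ctens U -> W := locked (clift iota).

Hypothesis csumK : forall w, csum (phi w) = w.

Lemma csum_hom : halg_hom csum.
Proof. by rewrite /csum -lock; exact: clift_hom. Qed.

Lemma csum_inj i (a : U i) : csum (inj a) = iota a.
Proof. by rewrite /csum -lock; exact: clift_inj. Qed.

Lemma csumE u : csum (pure u) = \prod_i iota (u i).
Proof. by rewrite /csum -lock; exact: cliftE. Qed.

Lemma phiK x : phi (csum x) = x.
Proof.
move: x; apply: (ctens_hom_eq (@ctens_sep _ _ U) (hom_comp phiH csum_hom) (hom_id _)).
by move=> i a /=; rewrite csum_inj phi_iota.
Qed.

Lemma phi_bij : bijective phi.
Proof. by exists csum; [exact: csumK|exact: phiK]. Qed.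

Lemma sum_total : htotal (fun u => csum (pure u)).
Proof.
apply: (htotal_comp (hom_lin csum_hom)) (@pure_total _ _ U) => w.
by exists (phi w).
Qed.

Section Hom.
Context {B : hAlgType C} {f : forall i, U i -> B}.
Hypotheses (cB : hcomplete B) (fH : forall i, halg_hom (@f i)).
Hypothesis fC : forall i j (a : U i) (b : U j), i != j -> f a * f b = f b * f a.

Definition sum_lift : W -> B := clift f \o phi.

Lemma sum_lift_hom : halg_hom sum_lift.
Proof. exact: hom_comp (clift_hom cB fH fC) phiH. Qed.

Lemma sum_lift_iota i (a : U i) : sum_lift (iota a) = f a.
Proof. by rewrite /sum_lift /= phi_iota (clift_inj cB). Qed.

End Hom.

Let P i : ctens2 (U i) -> ctens2 W := tens_map (@iota i).

Let PH i : halg_hom (@P i). Proof. exact: tens_map_hom. Qed.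

Let PC i j (x : ctens2 (U i)) (y : ctens2 (U j)) : i != j -> P x * P y = P y * P x.
Proof. by move=> ij; apply: tens_map_comm => // a b; exact: iotaC. Qed.

(** Applied to the pure tensor of the $R_i$ this is the glued R-matrix. Being an algebra map, it
    turns identities in $W\otimes W$ into componentwise ones. *)
Definition csum2 : ctens (fun i => ctens2 (U i)) -> ctens2 W := locked (clift P).

Lemma csum2_hom : halg_hom csum2.
Proof. by rewrite /csum2 -lock; exact: clift_hom (@ctens2_complete _ W) PH PC. Qed.

Lemma csum2E x : csum2 (pure x) = \prod_i P (x i).
Proof. by rewrite /csum2 -lock; exact: cliftE (@ctens2_complete _ W) PH x. Qed.

Lemma csum2M x y :
  csum2 (pure x) * csum2 (pure y) = csum2 (pure (fun i => x i * y i)).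
Proof. by rewrite pureM; exact: esym (homM csum2_hom _ _). Qed.

Lemma csum2_pure2 a b : csum2 (pure (fun i => pure2 (a i) (b i))) =
  pure2 (csum (pure a)) (csum (pure b)).
Proof.
rewrite csum2E !csumE -pure2_prod; apply: eq_bigr => i _.
exact: tens_mapE.
Qed.

Let P3 i : ctens3 (U i) -> ctens3 W := tens_map3 (@iota i).

Let P3H i : halg_hom (@P3 i). Proof. exact: tens_map3_hom. Qed.

Let P3C i j (x : ctens3 (U i)) (y : ctens3 (U j)) : i != j -> P3 x * P3 y = P3 y * P3 x.
Proof. by move=> ij; apply: tens_map3_comm => // a b; exact: iotaC. Qed.

Let csum3M (x y : forall i, ctens3 (U i)) :
  (\prod_(i : I) P3 (x i)) * (\prod_i P3 (y i)) = \prod_i P3 (x i * y i).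
Proof.
have xyC i j : i != j -> P3 (x i) * P3 (y j) = P3 (y j) * P3 (x i) by exact: P3C.
rewrite -(prodr_commM (index_enum_uniq I) xyC).
by apply: eq_bigr => i _; rewrite (homM (@P3H i)).
Qed.

(** The left side is a linear map with the values prescribed for [shuffle] on a dense family, so it
    also provides the existence behind that [linext]. *)
Lemma shuffle_csum2 x : tens_map phi (csum2 x) = shuffle x.
Proof.
rewrite /shuffle (linextE (p := tens_map phi \o csum2)) //.
- by case: (@ctens2_complete _ (ctens U)).
- move=> Y sY cY Yp; apply: (pure_family_total (fun i => @pair2_total _ (U i)) sY cY) => t.
  exact: (Yp (fun i => (t i).1, fun i => (t i).2)).
- exact: hlinear_comp (hom_lin (tens_map_hom phiH)) (hom_lin csum2_hom).
- move=> [a b]; apply: (etrans (congr1 (tens_map phi) (csum2_pure2 a b))).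
  by rewrite (tens_mapE phiH) (phiK (pure a)) (phiK (pure b)).
Qed.

Section Coproduct.
Context (D : forall i, U i -> ctens2 (U i)).
Hypothesis DH : forall i, halg_hom (@D i).

Let PDH i : halg_hom (fun a => P (@D i a)).
Proof. exact: hom_comp (@PH i) (DH i). Qed.

Definition sum_coprod : W -> ctens2 W := sum_lift (f := fun i a => P (@D i a)).

Lemma sum_coprod_hom : halg_hom sum_coprod.
Proof.
by apply: sum_lift_hom => [|//|i j a b ij]; [exact: ctens2_complete|exact: PC].
Qed.

Lemma sum_coprod_iota i (a : U i) : sum_coprod (iota a) = tens_map (@iota i) (D a).
Proof. by apply: (sum_lift_iota (@ctens2_complete _ W) PDH). Qed.

Lemma sum_coprod_csum u :
  sum_coprod (csum (pure u)) = csum2 (pure (fun i => D (u i))).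
Proof.
rewrite csumE csum2E (hom_prod sum_coprod_hom); apply: eq_bigr => i _.
exact: sum_coprod_iota.
Qed.

Context (R : forall i, ctens2 (U i)).

(** Both sides are linear in [w], which may be taken to be a product of elements of the summands.
    Then every term is [csum2] of a pure tensor, and the identity holds slot by slot. *)
Lemma csum2_intertwine : (forall i x, flip (D x) * R i = R i * D x) ->
  forall w, flip (sum_coprod w) * csum2 (pure R) = csum2 (pure R) * sum_coprod w.
Proof.
move=> RD; have s2 : hsep (ctens2 W) by case: (@ctens2_complete _ W).
apply: (htotal_eq s2 sum_total) => [||u].
- apply: hlinear_mulr; exact: hlinear_comp (hom_lin flip_hom) (hom_lin sum_coprod_hom).
- by apply: hlinear_mull; exact: hom_lin sum_coprod_hom.
have e : flip (sum_coprod (csum (pure u))) = csum2 (pure (fun i => flip (D (u i)))).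
  rewrite sum_coprod_csum !csum2E (hom_prod flip_hom); apply: eq_bigr => i _.
  exact: flip_map.
rewrite e sum_coprod_csum (csum2M _ R) (csum2M R).
by apply: (congr1 (fun x => csum2 (pure x))); apply: dfunext => i; exact: RD.
Qed.

(** Naturality gives the identity for the image of each [R i] in the tensor cube; images of
    different summands commute there, so the leg-13 and leg-23 factors can be separated. *)
Lemma csum2_tens_l : (forall i, tens_l (@D i) (R i) = leg13 (R i) * leg23 (R i)) ->
  tens_l sum_coprod (csum2 (pure R)) = leg13 (csum2 (pure R)) * leg23 (csum2 (pure R)).
Proof.
move=> RD; have e i : tens_l sum_coprod (P (R i)) = P3 (leg13 (R i) * leg23 (R i)).
  rewrite -RD; exact: (tens_l_map (iotaH i) (DH i) sum_coprod_hom (@sum_coprod_iota i)).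
rewrite csum2E (hom_prod (tens_l_hom sum_coprod_hom)) (hom_prod leg13_hom) (hom_prod leg23_hom).
have e13 i : leg13 (P (R i)) = P3 (leg13 (R i)) by exact: leg13_map.
have e23 i : leg23 (P (R i)) = P3 (leg23 (R i)) by exact: leg23_map.
rewrite (eq_bigr _ (fun i _ => e i)) (eq_bigr _ (fun i _ => e13 i)).
by rewrite (eq_bigr _ (fun i _ => e23 i)) csum3M.
Qed.

Lemma csum2_tens_r : (forall i, tens_r (@D i) (R i) = leg13 (R i) * leg12 (R i)) ->
  tens_r sum_coprod (csum2 (pure R)) = leg13 (csum2 (pure R)) * leg12 (csum2 (pure R)).
Proof.
move=> RD; have e i : tens_r sum_coprod (P (R i)) = P3 (leg13 (R i) * leg12 (R i)).
  rewrite -RD; exact: (tens_r_map (iotaH i) (DH i) sum_coprod_hom (@sum_coprod_iota i)).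
rewrite csum2E (hom_prod (tens_r_hom sum_coprod_hom)) (hom_prod leg13_hom) (hom_prod leg12_hom).
have e13 i : leg13 (P (R i)) = P3 (leg13 (R i)) by exact: leg13_map.
have e12 i : leg12 (P (R i)) = P3 (leg12 (R i)) by exact: leg12_map.
rewrite (eq_bigr _ (fun i _ => e i)) (eq_bigr _ (fun i _ => e13 i)).
by rewrite (eq_bigr _ (fun i _ => e12 i)) csum3M.
Qed.

Lemma csum2_inv (R' : forall i, ctens2 (U i)) : (forall i, R i * R' i = 1) ->
  csum2 (pure R) * csum2 (pure R') = 1.
Proof.
move=> RR'; rewrite csum2M -(hom1 csum2_hom) -pure_one.
by apply: (congr1 (fun x => csum2 (pure x))); apply: dfunext.
Qed.

(** Parts belonging to different summands commute, so all exponentials can be collected on the left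
    and merged into one; the remaining product of the $1+\Theta_i$ is $1$ plus an element of the
    closed span of [Y], as that span is multiplicatively closed. *)
Lemma csum2_standard_form (X : forall i, set (ctens2 (U i))) (Y : set (ctens2 W))
    (t Th : forall i, ctens2 (U i)) :
  (forall i, R i = hexp (t i) * (1 + Th i)) ->
  (forall i, closed_span (X i) (Th i)) ->
  (forall x y, Y x -> Y y -> Y (x * y)) ->
  (forall i x, X i x -> Y (tens_map (@iota i) x)) ->
  exists2 T, closed_span Y T &
    csum2 (pure R) = hexp (\sum_i tens_map (@iota i) (t i)) * (1 + T).
Proof.
move=> Re XTh YM XY; have [sY _] := closed_spanP Y.
have [s2 _] := @ctens2_complete _ W.
have [T YT eT] := prod1D_mul_closed (index_enum I) (t := fun i => P (Th i)) sY
  (closed_span_mul YM) (fun i => closed_span_map (hom_lin (@PH i)) (XY i) (XTh i)).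
exists T => //; rewrite csum2E -eT.
have e i : P (R i) = P (hexp (t i)) * (1 + P (Th i)).
  by rewrite Re (homM (@PH i)) (hlinD (hom_lin (@PH i))) (hom1 (@PH i)).
have tC i j : i != j ->
    P (hexp (t i)) * (1 + P (Th j)) = (1 + P (Th j)) * P (hexp (t i)).
  by move=> ij; rewrite mulrDl mulrDr mul1r mulr1 (PC _ _ ij).
rewrite (eq_bigr _ (fun i _ => e i)) (prodr_commM (index_enum_uniq I) tC).
congr (_ * _); rewrite (hexp_sum_comm _ _ (@ctens2_complete _ W)).
  by apply: eq_bigr => i _; exact: (hom_hexp _ (@ctens2_complete _ (U i)) s2 (@PH i)).
by move=> i j; have [->|ij] := eqVneq i j; [|exact: PC].
Qed.

End Coproduct.

Section Antipode.
Context (S : forall i, U i -> U i).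
Hypothesis SH : forall i, halg_antihom (@S i).

Let SL i : hlinear (@S i). Proof. by case: (SH i). Qed.

(** [sum_lift] glues homomorphisms only. The antipodes are therefore applied slotwise as linear
    maps; multiplication of pure tensors is slotwise, so reversing the order in each slot reverses
    it in [W]. *)
Definition sum_antipode : W -> W := csum \o cmap S \o phi.

Lemma sum_antipodeE u : sum_antipode (csum (pure u)) = csum (pure (fun i => S (u i))).
Proof. by rewrite /sum_antipode /= phiK cmapE. Qed.

Lemma sum_antipode_antihom : halg_antihom sum_antipode.
Proof.
have L : hlinear sum_antipode.
  apply: hlinear_comp (hom_lin phiH); apply: hlinear_comp (hom_lin csum_hom) _.
  exact: cmap_lin.
have [sW _] := cW; split=> //.
  rewrite -(hom1 csum_hom) -pure_one sum_antipodeE.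
  by apply: (congr1 (fun x => csum (pure x))); apply: dfunext => i; case: (SH i).
apply: (htotal_antimorphM sW sum_total L) => u v.
rewrite -(homM csum_hom) -pureM !sum_antipodeE -(homM csum_hom) -pureM.
by apply: (congr1 (fun x => csum (pure x))); apply: dfunext => i; case: (SH i).
Qed.

Lemma sum_antipode_iota i (a : U i) : sum_antipode (iota a) = iota (S a).
Proof.
have e : (fun j => S (1 : U j)) = (fun j => 1 : U j).
  by apply: dfunext => j; case: (SH j).
by rewrite -csum_inj sum_antipodeE -csum_inj (dfwith_map S) e.
Qed.

End Antipode.

Lemma pure_hscal (c : I -> fps C) u :
  pure (fun i => hscal (c i) * u i) = hscal (\prod_i c i) * pure u :> ctens U.
Proof.
rewrite pureM pureE hscal_prod; congr (_ * _).
by apply: eq_bigr => i _; exact: (hom_hscal (inj_hom i)).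
Qed.

(** Slicing the glued tensor amounts to slicing in each factor. Stated for an arbitrary factorwise
    bilinear [f], so that it serves both legs and hence both $l^+$ and $l^-$. *)
Lemma linext2_csum2 (f : W * W -> W) (fU : forall i, U i * U i -> U i) :
  (forall i, hcomplete (U i)) -> bilin f -> (forall i, bilin (@fU i)) ->
  (forall a b, f (csum (pure a), csum (pure b)) = csum (pure (fun i => fU i (a i, b i)))) ->
  forall x, linext (pair2 (U := W)) f (csum2 x) =
            csum (cmap (fun i => linext (pair2 (U := U i)) (@fU i)) x).
Proof.
move=> cU fB fUB fE; have [sW _] := cW.
have lU i : hlinear (linext (pair2 (U := U i)) (@fU i)) by exact: linext2_lin.
apply: (htotal_eq sW (pure_family_total (fun i => @pair2_total _ (U i)))) => [||t].
- exact: hlinear_comp (linext2_lin cW fB) (hom_lin csum2_hom).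
- exact: hlinear_comp (hom_lin csum_hom) (cmap_lin lU).
rewrite csum2_pure2 (linext2E cW fB) fE cmapE //; apply: (congr1 (fun x => csum (pure x))).
by apply: dfunext => i; rewrite (linext2E (cU i)).
Qed.

(** * Slices by products of matrix coefficients *)

Section MatrixCoefficients.
Context (S : forall i, U i -> U i) (t : forall i, U i -> fps C).
Hypotheses (cU : forall i, hcomplete (U i)) (SH : forall i, halg_antihom (@S i)).
Hypothesis tL : forall i, hlinear (@t i).

Let tprod : ctens U -> fps C := linext (@pure C I U) (fun u => \prod_i t (u i)).

Let tprodP : hlinear tprod /\ forall u, tprod (pure u) = \prod_i t (u i).
Proof.
have M := multilin_prod tL; have [sC _] := @fps_complete C.
have -> : tprod = mlift (fun u => \prod_i t (u i)).
  apply: (linextE sC (@pure_total _ _ U)); first exact: mlift_lin (@fps_complete C) M.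
  exact: mliftE (@fps_complete C) M.
by split=> [|u]; [exact: mlift_lin (@fps_complete C) M|exact: mliftE (@fps_complete C) M u].
Qed.

Let tsumL : hlinear (fun w => tprod (phi w)).
Proof. exact: hlinear_comp (proj1 tprodP) (hom_lin phiH). Qed.

Let tsumE u : tprod (phi (csum (pure u))) = \prod_i t (u i).
Proof. by rewrite phiK; exact: (proj2 tprodP). Qed.

Let hscal_csum c u :
  hscal (\prod_i c i) * csum (pure u) = csum (pure (fun i => hscal (c i) * u i)).
Proof. by rewrite pure_hscal (hlinZ (hom_lin csum_hom)). Qed.

Lemma sum_antipode_linext2 (f : W * W -> W) (fU : forall i, U i * U i -> U i) :
  bilin f -> (forall i, bilin (@fU i)) ->
  (forall a b, f (csum (pure a), csum (pure b)) = csum (pure (fun i => fU i (a i, b i)))) ->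
  forall x, phi (sum_antipode S (linext (pair2 (U := W)) f (csum2 (pure x)))) =
            pure (fun i => S (linext (pair2 (U := U i)) (@fU i) (x i))).
Proof.
move=> fB fUB fE x; rewrite (linext2_csum2 cU fB fUB fE) cmapE; last first.
  by move=> i; exact: linext2_lin (cU i) (fUB i).
by rewrite (sum_antipodeE SH) phiK.
Qed.

(** The coefficient of a tensor representation is a product of scalars, one of which is absorbed
    into each slot by [hscal_csum]. The slices are written out so that the formula for [mplus] is an
    instance up to conversion. *)
Lemma sum_antipode_lplus x :
  phi (sum_antipode S (linext (fun ab : W * W => pure2 ab.1 ab.2)
    (fun ab => hscal (tprod (phi ab.2)) * ab.1) (csum2 (pure x)))) =
  pure (fun i => S (linext (fun ab : U i * U i => pure2 ab.1 ab.2)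
    (fun ab => hscal (t ab.2) * ab.1) (x i))).
Proof.
apply: sum_antipode_linext2 => [|i|a b].
- exact: bilin_hscalr tsumL.
- exact: bilin_hscalr (@tL i).
- by rewrite tsumE hscal_csum.
Qed.

Lemma sum_antipode_lminus x :
  phi (sum_antipode S (linext (fun ab : W * W => pure2 ab.1 ab.2)
    (fun ab => hscal (tprod (phi ab.1)) * ab.2) (csum2 (pure x)))) =
  pure (fun i => S (linext (fun ab : U i * U i => pure2 ab.1 ab.2)
    (fun ab => hscal (t ab.1) * ab.2) (x i))).
Proof.
apply: sum_antipode_linext2 => [|i|a b].
- exact: bilin_hscall tsumL.
- exact: bilin_hscall (@tL i).
- by rewrite tsumE hscal_csum.
Qed.

End MatrixCoefficients.

End TensorSum.

(** * The quantum group of a direct sum *)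

Section QuantumParameter.
Local Open Scope ring_scope.
Context {C : numFieldType}.

Lemma fcoef_mulrz (x : fps C) (z : int) n : fcoef (x *~ z) n = fcoef x n *~ z.
Proof.
have mn m : fcoef (x *+ m) n = fcoef x n *+ m.
  by elim: m => [|m IH]; rewrite ?mulr0n // !mulrS /= IH.
by case: z => m; [exact: mn|rewrite !NegzE !mulrNz /= -!pmulrn mn].
Qed.

(** Modulo $h^2$, $e^{hz}=1+hz$. These two coefficients suffice to see that $q^d-q^{-d}$ is $2dh$
    plus higher terms, hence regular on the free algebra when $d>0$. *)
Lemma qpow_coef z : fcoef (qpow C z) 0 = 1 /\ fcoef (qpow C z) 1 = z%:~R.
Proof.
have [y] := hexpP (z%:~R : fps C) fps_complete 2.
have -> : hexp_sum (z%:~R : fps C) 2 = 1 + hvar C * z%:~R.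
  rewrite hexp_sumE big_ord_recl big_ord1 /= hpow0 factS fact0 muln1 invr1 !cst1.
  by rewrite !mul1r expr0 expr1.
move=> e; rewrite /qpow; split.
  by rewrite (fps_hvarX_coef e) //= big_ord1 /= mul0r addr0.
rewrite (fps_hvarX_coef e) //= !big_ord_recl big_ord0 /= mul0r add0r mul1r addr0.
by rewrite fcoef_mulrz add0r.
Qed.

Lemma qpow0 : qpow C 0 = 1.
Proof. by rewrite /qpow mulr0z hexp0 //; case: (@fps_complete C). Qed.

Lemma free_diff_reg (T : choiceType) (z : C) (p q : fps C) (x : free_halg C T) :
  z != 0 -> fcoef p 0 = 1 /\ fcoef p 1 = z -> fcoef q 0 = 1 /\ fcoef q 1 = - z ->
  hscal (p - q) * x = 0 -> x = 0.
Proof.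
move=> z0 [p0 p1] [q0 q1]; apply: free_hscal_reg; rewrite /= ?p0 ?q0 ?subrr //.
by rewrite p1 q1 opprK -mulr2n mulrn_eq0.
Qed.

Lemma free_qdiff_reg (T : choiceType) (d : nat) (x : free_halg C T) : (0 < d)%N ->
  hscal (qpow C d%:Z - qpow C (- d%:Z)) * x = 0 -> x = 0.
Proof.
move=> d0; apply: (free_diff_reg _ (qpow_coef d%:Z)); first by rewrite -pmulrn pnatr_eq0 -lt0n.
by have := qpow_coef (- d%:Z); rewrite mulrNz.
Qed.

End QuantumParameter.

Section UhTheory.
Local Open Scope ring_scope.
Local Open Scope classical_set_scope.
Context {C : numFieldType}.
Implicit Types (g : cartan) (B : hAlgType C).

Lemma Uh_complete g : hcomplete (Uh C g).
Proof. exact: hquot_complete free_complete. Qed.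

Lemma Uh_sep g : hsep (Uh C g).
Proof. by case: (Uh_complete g). Qed.

Lemma Uh_hom_eq g B (f f' : Uh C g -> B) : hsep B -> halg_hom f -> halg_hom f' ->
  (forall x, f (ugen C x) = f' (ugen C x)) -> f =1 f'.
Proof.
move=> sB fH f'H e; apply: hquot_hom_eq.
exact: gen_hom_eq sB (hom_comp fH (hpi_hom _)) (hom_comp f'H (hpi_hom _)) e.
Qed.

Lemma Uh_hom_comm1 g B (f : Uh C g -> B) (b : B) : hsep B -> halg_hom f ->
  (forall x, b * f (ugen C x) = f (ugen C x) * b) -> forall u, b * f u = f u * b.
Proof.
move=> sB fH bf u; have [x <-] := hpi_surj u; move: x.
have piH := hpi_hom (@uh_rel C g).
apply: (htotal_comm sB (word_total (T := gen (cI g))) (hom_lin (hom_comp fH piH))) => s.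
rewrite /word /= (hom_prod piH) (hom_prod fH).
elim: s => [|x s IH]; first by rewrite big_nil mulr1 mul1r.
by rewrite big_cons mulrA bf -!mulrA IH.
Qed.

Lemma Uh_hom_comm g g' B (f : Uh C g -> B) (f' : Uh C g' -> B) : hsep B ->
  halg_hom f -> halg_hom f' ->
  (forall x y, f (ugen C x) * f' (ugen C y) = f' (ugen C y) * f (ugen C x)) ->
  forall u v, f u * f' v = f' v * f u.
Proof.
move=> sB fH f'H ff' u; apply: (Uh_hom_comm1 sB f'H) => y.
by apply/esym; move: u; apply: (Uh_hom_comm1 sB fH) => x; rewrite ff'.
Qed.

Section Lift.
Context {g : cartan} {B : hAlgType C} (f : free_halg C (gen (cI g)) -> B).
Hypotheses (sB : hsep B) (fH : halg_hom f) (f_rel : forall r, uh_rel r -> f r = 0).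

Definition uh_lift : Uh C g -> B := locked (hquot_lift f).

Lemma uh_lift_hom : halg_hom uh_lift.
Proof. by rewrite /uh_lift -lock; exact: hquot_lift_hom. Qed.

Lemma uh_liftE x : uh_lift (hpi _ x) = f x.
Proof. by rewrite /uh_lift -lock; exact: hquot_lift_homE. Qed.

End Lift.

Lemma hom_serre_term (A B : hAlgType C) (f : A -> B) k l m (q : fps C) x y : halg_hom f ->
  f ((-1) ^+ k * hscal q * x ^+ l * y * x ^+ m) =
  (-1) ^+ k * hscal q * f x ^+ l * f y * f x ^+ m.
Proof.
move=> fH; rewrite !(homM fH) !(homX fH) (hom_hscal fH).
by rewrite (hlinN (hom_lin fH)) (hom1 fH).
Qed.

Lemma hom_serre g g' (f : free_halg C (gen (cI g)) -> free_halg C (gen (cI g')))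
    (h : cI g -> cI g') X X' i j :
  halg_hom f -> (forall a, f (X a) = X' (h a)) ->
  ca (h i) (h j) = ca i j -> cd (h i) = cd i ->
  f (serre X i j) = serre X' (h i) (h j).
Proof.
move=> fH fX ce de; rewrite /serre ce de (hlin_sum (hom_lin fH)).
by apply: eq_bigr => k _; rewrite (hom_serre_term _ _ _ _ _ _ fH) !fX.
Qed.

Lemma serre_term01 (A : hAlgType C) (x y : A) (q : fps C) : q = 1 ->
  (-1) ^+ 0 * hscal 1 * x ^+ 1 * y * x ^+ 0 + ((-1) ^+ 1 * hscal q * x ^+ 0 * y * x ^+ 1)
  = x * y - y * x.
Proof. by move=> ->; rewrite !expr0 !expr1 !hscal1 !mul1r !mulr1 mulN1r mulNr. Qed.

Lemma qbin11 d : qbin C d 1 1 = 1.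
Proof.
have e (A : pzRingType) (x y : A) : y = 1 -> x * 0 + y * 1 = 1.
  by move=> ->; rewrite mulr0 add0r mulr1.
apply: e; rewrite -qpow0; congr (qpow C _).
by rewrite subrr mulr0 oppr0.
Qed.

Lemma hom_comm (A B : hAlgType C) (f : A -> B) x y : halg_hom f ->
  f (x * y - y * x) = f x * f y - f y * f x.
Proof. by move=> fH; rewrite (hlinB (hom_lin fH)) !(homM fH). Qed.

Lemma hom_comm_eq0 (A B : hAlgType C) (f : A -> B) x y a b : halg_hom f ->
  f x = a -> f y = b -> a * b = b * a -> f (x * y - y * x) = 0.
Proof. by move=> fH <- <- e; rewrite (hom_comm _ _ fH) e subrr. Qed.

Lemma hom_comm_subz (A B : hAlgType C) (f : A -> B) x y (z : int) : halg_hom f ->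
  f (x * y - y * x - y *~ z) = f x * f y - f y * f x - f y *~ z.
Proof.
by move=> fH; rewrite (hlinB (hom_lin fH)) (hom_comm _ _ fH) (hlin_mulrz (hom_lin fH)).
Qed.

Lemma hom_comm_addz (A B : hAlgType C) (f : A -> B) x y (z : int) : halg_hom f ->
  f (x * y - y * x + y *~ z) = f x * f y - f y * f x + f y *~ z.
Proof.
by move=> fH; rewrite (hlinD (hom_lin fH)) (hom_comm _ _ fH) (hlin_mulrz (hom_lin fH)).
Qed.

(** The relation for $[E_i,F_j]$ has no closed formula for [r]; what a homomorphism transports is
    its defining equation, exponentials included. *)
Lemma hom_EF (A B : hAlgType C) (f : A -> B) (q : fps C) x y r t (d : nat) (b : bool) :
  hcomplete A -> hsep B -> halg_hom f ->
  hscal q * (x * y - y * x - r) = (hexp (t *+ d) - hexp (- (t *+ d))) *+ b ->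
  hscal q * (f x * f y - f y * f x - f r) = (hexp (f t *+ d) - hexp (- (f t *+ d))) *+ b.
Proof.
move=> cA sB fH; have fL := hom_lin fH; move=> /(congr1 f).
rewrite (hlinZ fL) (hlinB fL) (hom_comm _ _ fH) => ->.
rewrite (hlin_mulrn fL) (hlinB fL) !(hom_hexp _ cA sB fH) (hlinN fL).
by rewrite (hlin_mulrn fL).
Qed.

(** For $a_{ij}=0$ the sum has two terms with both q-binomials equal to 1. This is why the $E$'s,
    and the $F$'s, of different summands commute. *)
Lemma serre_ca0 g (X : cI g -> free_halg C (gen (cI g))) i j : ca i j = 0 ->
  serre X i j = X i * X j - X j * X i.
Proof.
move=> c0; rewrite /serre c0 subr0 absz1 big_ord_recl big_ord1.
exact: serre_term01 (qbin11 _).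
Qed.

End UhTheory.

Section DirectSum.
Local Open Scope ring_scope.
Local Open Scope classical_set_scope.
Context {C : numFieldType} {n : nat} {g : 'I_n -> cartan}.
Hypothesis cd_gt0 : forall i (a : cI (g i)), (0 < cd a)%N.

Local Notation G := (dsum g).
Local Notation Free g := (free_halg C (gen (cI g))).
Local Notation H a := (fgen C (GH a) : Free _).
Local Notation E a := (fgen C (GE a) : Free _).
Local Notation F a := (fgen C (GF a) : Free _).
Local Notation inc i a := (Tagged (fun i => cI (g i)) (a : cI (g i)) : cI G).

Lemma dsum_ca i (a b : cI (g i)) : ca (inc i a) (inc i b) = ca a b.
Proof. by rewrite /= eqxx tagged_asE. Qed.

Lemma dsum_ca0 i j (a : cI (g i)) (b : cI (g j)) : i != j -> ca (inc i a) (inc j b) = 0.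
Proof. by move=> /negPf /= ->. Qed.

Lemma inc_eq i (a b : cI (g i)) : (inc i a == inc i b) = (a == b).
Proof. by rewrite eq_Tagged. Qed.

Lemma inc_neq i j (a : cI (g i)) (b : cI (g j)) : i != j -> inc i a != inc j b.
Proof. by apply: contraNneq => /(congr1 tag)/= ->. Qed.

Definition free_inc i : Free (g i) -> Free G := gen_lift (fun x => fgen C (dsum_gen x)).

Lemma free_inc_hom i : halg_hom (@free_inc i).
Proof. exact: gen_lift_hom free_complete. Qed.

Lemma free_inc_gen i x : @free_inc i (fgen C x) = fgen C (dsum_gen x).
Proof. exact: gen_liftE free_complete _. Qed.

Lemma free_inc_EF i (a b : cI (g i)) r :
  hscal (qpow C (cd a)%:Z - qpow C (- (cd a)%:Z)) * (E a * F b - F b * E a - r)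
    = (hexp (H a *+ cd a) - hexp (- (H a *+ cd a))) *+ (a == b) ->
  hscal (qpow C (cd (inc i a))%:Z - qpow C (- (cd (inc i a))%:Z)) *
    (E (inc i a) * F (inc i b) - F (inc i b) * E (inc i a) - free_inc r)
  = (hexp (H (inc i a) *+ cd (inc i a)) - hexp (- (H (inc i a) *+ cd (inc i a))))
      *+ (inc i a == inc i b).
Proof.
have [sF _] := @free_complete C (gen (cI G)).
rewrite inc_eq => /(hom_EF free_complete sF (@free_inc_hom i)).
by rewrite (free_inc_gen (GE a)) (free_inc_gen (GF b)) (free_inc_gen (GH a)).
Qed.

Lemma free_inc_serreE i (a b : cI (g i)) :
  free_inc (serre (fun c => E c) a b) = serre (fun u => E u) (inc i a) (inc i b).
Proof.
apply: (hom_serre (h := fun a => inc i a) (X' := fun u => E u) (@free_inc_hom i)).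
- by move=> c; exact: free_inc_gen.
- exact: dsum_ca.
- by [].
Qed.

Lemma free_inc_serreF i (a b : cI (g i)) :
  free_inc (serre (fun c => F c) a b) = serre (fun u => F u) (inc i a) (inc i b).
Proof.
apply: (hom_serre (h := fun a => inc i a) (X' := fun u => F u) (@free_inc_hom i)).
- by move=> c; exact: free_inc_gen.
- exact: dsum_ca.
- by [].
Qed.

Lemma free_inc_HH i (a b : cI (g i)) : free_inc (H a * H b - H b * H a) =
  H (inc i a) * H (inc i b) - H (inc i b) * H (inc i a).
Proof.
by rewrite (hom_comm _ _ (@free_inc_hom i)) (free_inc_gen (GH a)) (free_inc_gen (GH b)).
Qed.

Lemma free_inc_HE i (a b : cI (g i)) : free_inc (H a * E b - E b * H a - E b *~ ca a b) =
  H (inc i a) * E (inc i b) - E (inc i b) * H (inc i a)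
    - E (inc i b) *~ ca (inc i a) (inc i b).
Proof.
rewrite (hom_comm_subz _ _ _ (@free_inc_hom i)) dsum_ca.
by rewrite (free_inc_gen (GH a)) (free_inc_gen (GE b)).
Qed.

Lemma free_inc_HF i (a b : cI (g i)) : free_inc (H a * F b - F b * H a + F b *~ ca a b) =
  H (inc i a) * F (inc i b) - F (inc i b) * H (inc i a)
    + F (inc i b) *~ ca (inc i a) (inc i b).
Proof.
rewrite (hom_comm_addz _ _ _ (@free_inc_hom i)) dsum_ca.
by rewrite (free_inc_gen (GH a)) (free_inc_gen (GF b)).
Qed.

Lemma uh_rel_inc i r : @uh_rel C (g i) r -> uh_rel (free_inc r).
Proof.
case=> [a b|a b|a b|a b {}r|a b ab|a b ab].
- by rewrite free_inc_HH; exact: uh_HH.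
- by rewrite free_inc_HE; exact: uh_HE.
- by rewrite free_inc_HF; exact: uh_HF.
- by move=> /free_inc_EF; exact: uh_EF.
- by rewrite free_inc_serreE; apply: uh_EE; rewrite inc_eq.
- by rewrite free_inc_serreF; apply: uh_FF; rewrite inc_eq.
Qed.

Definition dsum_inc i : Uh C (g i) -> Uh C G := uh_lift (hpi (@uh_rel C G) \o @free_inc i).

Let inc_lift i : halg_hom (hpi (@uh_rel C G) \o @free_inc i).
Proof. exact: hom_comp (hpi_hom _) (@free_inc_hom i). Qed.

Let inc_kill i r : @uh_rel C (g i) r -> (hpi (@uh_rel C G) \o @free_inc i) r = 0.
Proof. by move=> /uh_rel_inc; exact: hpi_eq0. Qed.

Lemma dsum_inc_hom i : halg_hom (@dsum_inc i).
Proof. exact: uh_lift_hom (@Uh_sep _ G) (@inc_lift i) (@inc_kill i). Qed.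

Lemma dsum_inc_ugen i (x : gen (cI (g i))) : dsum_inc (ugen C x) = ugen C (dsum_gen x).
Proof.
rewrite /dsum_inc /ugen (uh_liftE (@Uh_sep _ G) (@inc_lift i) (@inc_kill i)) /=.
by rewrite free_inc_gen.
Qed.

Let ugen_comm (x y : gen (cI G)) :
  uh_rel (fgen C x * fgen C y - fgen C y * fgen C x : Free G) ->
  ugen C x * ugen C y = ugen C y * ugen C x.
Proof.
move=> /hpi_eq0; have piH := hpi_hom (@uh_rel C G).
rewrite (hom_comm _ _ piH) => /eqP.
by rewrite subr_eq0 => /eqP.
Qed.

(** It suffices to treat generators, and across summands all Cartan entries vanish: each defining
    relation then degenerates to a commutator. *)
Lemma dsum_inc_comm i j (a : Uh C (g i)) (b : Uh C (g j)) : i != j ->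
  dsum_inc a * dsum_inc b = dsum_inc b * dsum_inc a.
Proof.
move=> ij; move: a b.
apply: (Uh_hom_comm (@Uh_sep _ G) (@dsum_inc_hom i) (@dsum_inc_hom j)) => x y.
rewrite !dsum_inc_ugen.
have HE k l (a : cI (g k)) (b : cI (g l)) : k != l ->
    uh_rel (H (inc k a) * E (inc l b) - E (inc l b) * H (inc k a) : Free G).
  by move=> kl; have := uh_HE C (inc k a) (inc l b); rewrite dsum_ca0 // mulr0z subr0.
have HF k l (a : cI (g k)) (b : cI (g l)) : k != l ->
    uh_rel (H (inc k a) * F (inc l b) - F (inc l b) * H (inc k a) : Free G).
  by move=> kl; have := uh_HF C (inc k a) (inc l b); rewrite dsum_ca0 // mulr0z addr0.
have EF k l (a : cI (g k)) (b : cI (g l)) : k != l ->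
    uh_rel (E (inc k a) * F (inc l b) - F (inc l b) * E (inc k a) : Free G).
  (* Taking [r] to be the whole commutator makes the left side of the defining equation zero, and so
     is the right side for distinct indices. *)
  move=> kl; apply: (@uh_EF _ _ (inc k a) (inc l b)).
  have q0 (A : pzRingType) (q z : A) : q * (z - z) = 0 by rewrite subrr mulr0.
  by rewrite (negPf (inc_neq a b kl)) mulr0n; exact: q0.
have ji : j != i by rewrite eq_sym.
case: x y => a [] b.
- apply: ugen_comm; exact: uh_HH.
- by apply: ugen_comm; exact: HE.
- by apply: ugen_comm; exact: HF.
- by apply/esym/ugen_comm; exact: HE.
- apply: ugen_comm; have := uh_EE C (inc_neq a b ij).
  by rewrite serre_ca0 // dsum_ca0.
- by apply: ugen_comm; exact: EF.
- by apply/esym/ugen_comm; exact: HF.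
- by apply/esym/ugen_comm; exact: EF.
- apply: ugen_comm; have := uh_FF C (inc_neq a b ij).
  by rewrite serre_ca0 // dsum_ca0.
Qed.

Definition gen_split (y : gen (cI G)) : {i & gen (cI (g i))} :=
  match y with
  | GH u => Tagged (fun i => gen (cI (g i))) (GH (tagged u))
  | GE u => Tagged (fun i => gen (cI (g i))) (GE (tagged u))
  | GF u => Tagged (fun i => gen (cI (g i))) (GF (tagged u))
  end.

Lemma gen_splitK y : dsum_gen (tagged (gen_split y)) = y.
Proof. by case: y => -[]. Qed.

Lemma dsum_genK i (x : gen (cI (g i))) :
  gen_split (dsum_gen x) = Tagged (fun i => gen (cI (g i))) x.
Proof. by case: x. Qed.

(** Kills the generators of all other summands and so retracts [free_inc i]; it serves to pull a
    solution [r] back to one summand. Selecting the value by [dfwith] avoids a cast along an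
    equality of tags. *)
Definition free_proj i : Free G -> Free (g i) := gen_lift (fun y =>
  dfwith (T := fun k => gen (cI (g k)) -> Free (g i)) (fun k => fun=> 0) (@fgen C _)
         (tag (gen_split y)) (tagged (gen_split y))).

Lemma free_proj_hom i : halg_hom (@free_proj i).
Proof. exact: gen_lift_hom free_complete. Qed.

Lemma free_proj_gen i x : free_proj i (fgen C (dsum_gen x)) = fgen C (x : gen (cI (g i))).
Proof. by rewrite /free_proj gen_liftE ?dsum_genK ?dfwith_in //; exact: free_complete. Qed.

(* The defining equation determines r, since q^d - q^-d is not a zero divisor;
   hence r comes from the i-th summand. *)
Lemma free_projK_EF i (a b : cI (g i)) (r : Free G) :
  hscal (qpow C (cd (inc i a))%:Z - qpow C (- (cd (inc i a))%:Z)) *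
    (E (inc i a) * F (inc i b) - F (inc i b) * E (inc i a) - r)
  = (hexp (H (inc i a) *+ cd (inc i a)) - hexp (- (H (inc i a) *+ cd (inc i a))))
      *+ (inc i a == inc i b) ->
  uh_rel (free_proj i r) /\ free_inc (free_proj i r) = r.
Proof.
move=> re; have [sF _] := @free_complete C (gen (cI (g i))).
have pre : hscal (qpow C (cd a)%:Z - qpow C (- (cd a)%:Z)) *
      (E a * F b - F b * E a - free_proj i r)
    = (hexp (H a *+ cd a) - hexp (- (H a *+ cd a))) *+ (a == b).
  move: re; rewrite inc_eq => /(hom_EF free_complete sF (@free_proj_hom i)).
  by rewrite (free_proj_gen (GE a)) (free_proj_gen (GF b)) (free_proj_gen (GH a)).
split; first exact: uh_EF pre.
apply/eqP; rewrite -subr_eq0; apply/eqP; apply: (free_qdiff_reg (cd_gt0 a)).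
have := free_inc_EF pre; rewrite -re => /eqP; rewrite -subr_eq0 -mulrBr => /eqP e.
rewrite -[RHS]oppr0 -[in RHS]e -mulrN; congr (_ * _).
by rewrite opprB opprD opprK addrACA subrr add0r addrC.
Qed.

Let phi_gen (y : gen (cI G)) : ctens (fun i => Uh C (g i)) :=
  inj (ugen C (tagged (gen_split y))).

Definition free_phi : Free G -> ctens (fun i => Uh C (g i)) := gen_lift phi_gen.

Lemma free_phi_hom : halg_hom free_phi.
Proof. exact: gen_lift_hom (@ctens_complete _ _ _). Qed.

Lemma free_phi_gen i (x : gen (cI (g i))) : free_phi (fgen C (dsum_gen x)) = inj (ugen C x).
Proof.
rewrite /free_phi (gen_liftE _ (@ctens_complete _ _ _)) /phi_gen dsum_genK.
by [].
Qed.

Lemma free_phi_inc i r : free_phi (free_inc r) = inj (hpi (@uh_rel C (g i)) r).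
Proof.
move: r; apply: (gen_hom_eq (@ctens_sep _ _ _) (hom_comp free_phi_hom (@free_inc_hom i))
  (hom_comp (inj_hom i) (hpi_hom _))) => x /=.
by rewrite free_inc_gen free_phi_gen.
Qed.

Let free_phi_same i r : @uh_rel C (g i) r -> free_phi (free_inc r) = 0.
Proof. by move=> /hpi_eq0 e; rewrite free_phi_inc e; exact: hlin0 (hom_lin (inj_hom i)). Qed.

Let free_phi_comm i j (x : gen (cI (g i))) (y : gen (cI (g j))) : i != j ->
  free_phi (fgen C (dsum_gen x) * fgen C (dsum_gen y) -
            fgen C (dsum_gen y) * fgen C (dsum_gen x)) = 0.
Proof.
move=> ij.
exact: (hom_comm_eq0 free_phi_hom (free_phi_gen x) (free_phi_gen y) (inj_comm _ _ ij)).
Qed.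

(** Each of the six relations splits according to whether its indices share a summand. If they do,
    it is the image of a relation of that summand; if not, it is a commutator, and different slots
    of the tensor product commute. *)
Lemma free_phi_rel r : @uh_rel C G r -> free_phi r = 0.
Proof.
case=> [[i a] [j b]|[i a] [j b]|[i a] [j b]|[i a] [j b] {}r|[i a] [j b] uv|[i a] [j b] uv];
  have [ij|ij] := eqVneq i j; try (subst j).
- by have := free_phi_same (uh_HH C a b); rewrite free_inc_HH.
- exact: (free_phi_comm (GH a) (GH b)).
- by have := free_phi_same (uh_HE C a b); rewrite free_inc_HE.
- by rewrite dsum_ca0 // mulr0z subr0; exact: (free_phi_comm (GH a) (GE b)).
- by have := free_phi_same (uh_HF C a b); rewrite free_inc_HF.
- by rewrite dsum_ca0 // mulr0z addr0; exact: (free_phi_comm (GH a) (GF b)).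
- by move=> /free_projK_EF [re <-]; exact: free_phi_same.
(* With right-hand side zero, regularity of $q^d-q^{-d}$ forces [r] to be the commutator itself. *)
- rewrite (negPf (inc_neq a b ij)) mulr0n => /free_qdiff_reg e.
  have := free_phi_comm (GE a) (GF b) ij.
  suff -> : r = E (inc i a) * F (inc j b) - F (inc j b) * E (inc i a) by exact.
  by apply/esym/eqP; rewrite -subr_eq0; apply/eqP/e; exact: cd_gt0.
- by have := free_phi_same (uh_EE C (i := a) (j := b) _);
    rewrite free_inc_serreE; apply; rewrite -(inc_eq a b).
- by rewrite serre_ca0 ?dsum_ca0 //; exact: (free_phi_comm (GE a) (GE b)).
- by have := free_phi_same (uh_FF C (i := a) (j := b) _);
    rewrite free_inc_serreF; apply; rewrite -(inc_eq a b).
- by rewrite serre_ca0 ?dsum_ca0 //; exact: (free_phi_comm (GF a) (GF b)).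
Qed.

Definition dsum_phi : Uh C G -> ctens (fun i => Uh C (g i)) := uh_lift free_phi.

Lemma dsum_phi_hom : halg_hom dsum_phi.
Proof. exact: uh_lift_hom (@ctens_sep _ _ _) free_phi_hom free_phi_rel. Qed.

Lemma dsum_phi_ugen i (x : gen (cI (g i))) :
  dsum_phi (ugen C (dsum_gen x)) = inj (ugen C x).
Proof.
rewrite /dsum_phi /ugen (uh_liftE (@ctens_sep _ _ _) free_phi_hom free_phi_rel).
exact: free_phi_gen.
Qed.

Lemma dsum_phi_inc i (u : Uh C (g i)) : dsum_phi (dsum_inc u) = inj u.
Proof.
move: u; apply: (Uh_hom_eq (@ctens_sep _ _ _) (hom_comp dsum_phi_hom (@dsum_inc_hom i))
  (inj_hom i)) => x /=.
by rewrite dsum_inc_ugen dsum_phi_ugen.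
Qed.

Lemma dsum_csumK (w : Uh C G) : csum (@dsum_inc) (dsum_phi w) = w.
Proof.
have sH := csum_hom (@Uh_complete C G) dsum_inc_hom dsum_inc_comm.
move: w; apply: (Uh_hom_eq (@Uh_sep _ G) (hom_comp sH dsum_phi_hom) (hom_id _)) => y /=.
rewrite -(gen_splitK y) dsum_phi_ugen.
by rewrite (csum_inj (@Uh_complete C G) dsum_inc_hom) dsum_inc_ugen.
Qed.

End DirectSum.

(** * Hopf structure, R-matrix and FRT-generators of a direct sum *)

Section DirectSumHopf.
Local Open Scope ring_scope.
Local Open Scope classical_set_scope.
Context {C : numFieldType} {n : nat} {g : 'I_n -> cartan}.
Hypothesis cd_gt0 : forall i (a : cI (g i)), (0 < cd a)%N.
Context (D : forall i, uh_hopf C (g i)).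

Local Notation G := (dsum g).
Local Notation W := (Uh C G).
Local Notation U i := (Uh C (g i)).
Local Notation inc i a := (Tagged (fun i => cI (g i)) (a : cI (g i)) : cI G).
Local Notation iota := (@dsum_inc C n g).
Local Notation phi := (@dsum_phi C n g).

Let cW : hcomplete W := @Uh_complete C G.
Let iotaH : forall i, halg_hom (@dsum_inc C n g i) := @dsum_inc_hom C n g.
Let iotaC := @dsum_inc_comm C n g.
Let phiH : halg_hom phi := dsum_phi_hom cd_gt0.
Let phi_iota := @dsum_phi_inc C n g cd_gt0.
Let csumK := @dsum_csumK C n g cd_gt0.

Definition dsum_coprod : W -> ctens2 W := sum_coprod iota phi (fun i => coprod (D i)).
Definition dsum_counit : W -> fps C := sum_lift phi (f := fun i => counit (D i)).
Definition dsum_antipode : W -> W := sum_antipode iota phi (fun i => antipode (D i)).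

Let DH i : halg_hom (coprod (D i)) := coprod_hom (D i).
Let SH i : halg_antihom (antipode (D i)) := antipode_antihom (D i).
Let eH i : halg_hom (counit (D i)) := counit_hom (D i).

Let coprodi i (u : U i) : dsum_coprod (iota u) = tens_map (@dsum_inc C n g i) (coprod (D i) u).
Proof. exact: (sum_coprod_iota iotaH phi_iota DH). Qed.

Let antipodei i (u : U i) : dsum_antipode (iota u) = iota (antipode (D i) u).
Proof. exact: (sum_antipode_iota cW iotaH iotaC phiH phi_iota SH). Qed.

Lemma dsum_inc_hexp i (u : U i) : iota (hexp u) = hexp (iota u).
Proof. exact: hom_hexp _ (@Uh_complete C (g i)) (@Uh_sep C G) (@iotaH i). Qed.

Lemma dsum_inc_uK i a : iota (uK C a) = uK C (inc i a).
Proof.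
rewrite /uK dsum_inc_hexp (hlin_mulrn (hom_lin (@iotaH i))).
by rewrite (dsum_inc_ugen (GH a)).
Qed.

Lemma dsum_inc_uKV i a : iota (uKV C a) = uKV C (inc i a).
Proof.
rewrite /uKV dsum_inc_hexp (hlinN (hom_lin (@iotaH i))) (hlin_mulrn (hom_lin (@iotaH i))).
by rewrite (dsum_inc_ugen (GH a)).
Qed.

Let tmapE i (a b : U i) : tens_map (@dsum_inc C n g i) (pure2 a b) = pure2 (iota a) (iota b).
Proof. exact: (tens_mapE (@iotaH i)). Qed.

Let iota1 i : iota (1 : U i) = 1.
Proof. exact: hom1 (@iotaH i). Qed.

Let incP (P : cI G -> Prop) : (forall i a, P (inc i a)) -> forall u, P u.
Proof. by move=> Pi [i a]; exact: Pi. Qed.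

Let ugenH i a : ugen C (GH (inc i a)) = iota (ugen C (GH a)).
Proof. exact: esym (dsum_inc_ugen (GH a)). Qed.
Let ugenE i a : ugen C (GE (inc i a)) = iota (ugen C (GE a)).
Proof. exact: esym (dsum_inc_ugen (GE a)). Qed.
Let ugenF i a : ugen C (GF (inc i a)) = iota (ugen C (GF a)).
Proof. exact: esym (dsum_inc_ugen (GF a)). Qed.

Lemma dsum_coprodH u :
  dsum_coprod (ugen C (GH u)) = pure2 (ugen C (GH u)) 1 + pure2 1 (ugen C (GH u)).
Proof.
move: u; apply: incP => i a; rewrite ugenH (coprodi (ugen C (GH a))) (coprodH (D i) a).
apply: (tens_map_pure2D (@iotaH i)); [exact: erefl|exact: iota1|exact: iota1|exact: erefl].
Qed.

Lemma dsum_coprodE u :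
  dsum_coprod (ugen C (GE u)) = pure2 (ugen C (GE u)) (uK C u) + pure2 1 (ugen C (GE u)).
Proof.
move: u; apply: incP => i a; rewrite ugenE (coprodi (ugen C (GE a))) (coprodE (D i) a).
apply: (tens_map_pure2D (@iotaH i)); [exact: erefl|exact: dsum_inc_uK|exact: iota1|exact: erefl].
Qed.

Lemma dsum_coprodF u :
  dsum_coprod (ugen C (GF u)) = pure2 (ugen C (GF u)) 1 + pure2 (uKV C u) (ugen C (GF u)).
Proof.
move: u; apply: incP => i a; rewrite ugenF (coprodi (ugen C (GF a))) (coprodF (D i) a).
apply: (tens_map_pure2D (@iotaH i)); [exact: erefl|exact: iota1|exact: dsum_inc_uKV|exact: erefl].
Qed.

Lemma dsum_counit_hom : halg_hom dsum_counit.
Proof. by apply: (sum_lift_hom phiH (@fps_complete C) eH) => *; exact: mulrC. Qed.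

Lemma dsum_counit_gen x : dsum_counit (ugen C x) = 0.
Proof.
rewrite -(gen_splitK x) -dsum_inc_ugen.
by rewrite /dsum_counit (sum_lift_iota phi_iota (@fps_complete C) eH) counit_gen.
Qed.

Lemma dsum_antipodeH u : dsum_antipode (ugen C (GH u)) = - ugen C (GH u).
Proof.
move: u; apply: incP => i a; rewrite ugenH antipodei antipodeH.
exact: hlinN (hom_lin (@iotaH i)) _.
Qed.

Lemma dsum_antipodeE u : dsum_antipode (ugen C (GE u)) = - (ugen C (GE u) * uKV C u).
Proof.
move: u; apply: incP => i a; rewrite ugenE antipodei antipodeE.
by rewrite (hlinN (hom_lin (@iotaH i))) (homM (@iotaH i)) dsum_inc_uKV.
Qed.

Lemma dsum_antipodeF u : dsum_antipode (ugen C (GF u)) = - (uK C u * ugen C (GF u)).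
Proof.
move: u; apply: incP => i a; rewrite ugenF antipodei antipodeF.
by rewrite (hlinN (hom_lin (@iotaH i))) (homM (@iotaH i)) dsum_inc_uK.
Qed.

Definition dsum_hopf : uh_hopf C G := UhHopf
  (sum_coprod_hom iotaH iotaC phiH DH) dsum_coprodH dsum_coprodE dsum_coprodF
  dsum_counit_hom dsum_counit_gen
  (sum_antipode_antihom cW iotaH iotaC phiH phi_iota csumK SH)
  dsum_antipodeH dsum_antipodeE dsum_antipodeF.

Section RMatrix.
Context (RR : forall i, ctens2 (U i)).
Hypothesis RR_univ : forall i, universal_R (D i) (RR i).

Definition dsum_R : ctens2 W := csum2 iota (pure RR).

Lemma dsum_quasitriangular : quasitriangular dsum_hopf dsum_R.
Proof.
have R' i : {R' | RR i * R' = 1 /\ R' * RR i = 1}.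
  by apply: cid; have [[]] := RR_univ i.
split.
- exists (csum2 iota (pure (fun i => sval (R' i)))).
  by split; apply: (csum2_inv iotaH iotaC) => i; have [] := svalP (R' i).
- apply: (csum2_intertwine cW iotaH iotaC phiH phi_iota csumK DH) => i x.
  by have [[]] := RR_univ i.
- apply: (csum2_tens_l iotaH iotaC phiH phi_iota DH) => i.
  by have [[]] := RR_univ i.
- apply: (csum2_tens_r iotaH iotaC phiH phi_iota DH) => i.
  by have [[]] := RR_univ i.
Qed.

Lemma EF_words_mul (h : cartan) x y :
  @EF_words C h x -> EF_words y -> EF_words (x * y).
Proof.
move=> [s [t [s0 t0 ->]]] [s' [t' [s0' t0' ->]]]; exists (s ++ s'), (t ++ t').
split; first by case: s s0.
  by case: t t0.
by rewrite -pure2M !big_cat.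
Qed.

Lemma EF_words_inc i x : @EF_words C (g i) x -> EF_words (tens_map (@dsum_inc C n g i) x).
Proof.
move=> [s [t [s0 t0 ->]]].
exists [seq inc i a | a <- s], [seq inc i a | a <- t].
split; [by case: s s0|by case: t t0|].
have eE : \prod_(u <- [seq inc i a | a <- s]) ugen C (GE u) =
    iota (\prod_(a <- s) ugen C (GE a)).
  by rewrite big_map (hom_prod (@iotaH i)); apply: eq_bigr => a _; exact: ugenE.
have eF : \prod_(u <- [seq inc i a | a <- t]) ugen C (GF u) =
    iota (\prod_(a <- t) ugen C (GF a)).
  by rewrite big_map (hom_prod (@iotaH i)); apply: eq_bigr => a _; exact: ugenF.
by rewrite eE eF; exact: tmapE.
Qed.

(** The matrix $(d_j^{-1}a_{ij})$ of the sum is block diagonal, so its inverse is assembled from the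
    inverses of the blocks. *)
Definition block_diag (B : forall i, cI (g i) -> cI (g i) -> rat) (u v : cI G) : rat :=
  if tag u == tag v then B (tag u) (tagged u) (tagged_as u v) else 0.

Lemma block_diag_same B i a b : block_diag B (inc i a) (inc i b) = B i a b.
Proof. by rewrite /block_diag /= eqxx tagged_asE. Qed.

Lemma block_diag_diff B i j a b : i != j -> block_diag B (inc i a) (inc j b) = 0.
Proof. by rewrite /block_diag /= => /negPf->. Qed.

Lemma big_dsum (A : nmodType) (f : cI G -> A) :
  \sum_u f u = \sum_i \sum_(a : cI (g i)) f (inc i a).
Proof.
by rewrite (sig_big_dep (J := fun i => cI (g i)) xpredT (fun=> xpredT)
  (fun i a => f (inc i a))) /=; apply: eq_bigr => -[].
Qed.

Lemma block_diag_inv B :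
  (forall i a b, \sum_k B i a k * ((ca k b)%:~R / (cd b)%:R) = (a == b)%:R) ->
  forall u v : cI G,
    \sum_k block_diag B u k * ((ca k v)%:~R / (cd v)%:R) = (u == v)%:R.
Proof.
move=> BI [i a] [j b]; rewrite big_dsum (bigD1 i) //.
rewrite [\sum_(k | k != i) _]big1 => [|k ki]; last first.
  by rewrite big1 // => c _; rewrite block_diag_diff 1?eq_sym // mul0r.
rewrite Monoid.mulm1; have [ij|ij] := eqVneq i j.
  subst j; rewrite (inc_eq a b) -BI; apply: eq_bigr => c _.
  by rewrite block_diag_same (dsum_ca c b).
rewrite (negPf (inc_neq a b ij)) big1 // => c _.
by rewrite (dsum_ca0 c b ij) mul0r mulr0.
Qed.

(** [csum2_standard_form] does the work once witnesses [B] and [Theta] are chosen for all summands;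
    what remains is to recognize the sum of the transported exponents as the exponent of the block
    diagonal matrix. *)
Lemma dsum_standard_form : standard_form dsum_R.
Proof.
have RRf i : {B & {Theta | [/\ forall a b,
     \sum_k B a k * ((ca k b)%:~R / (cd b)%:R) = (a == b)%:R,
    closed_span (@EF_words C (g i)) Theta
  & RR i = hexp (\sum_a \sum_b cst (ratr (B a b)) *
       pure2 (ugen C (GH a)) (ugen C (GH b))) * (1 + Theta)]}}.
  have [_ /cid[B /cid Bi]] := RR_univ i; by exists B.
pose B i := projT1 (RRf i); pose Th i := sval (projT2 (RRf i)).
have BI i : forall a b, \sum_k B i a k * ((ca k b)%:~R / (cd b)%:R) = (a == b)%:R.
  by have [] := svalP (projT2 (RRf i)).
have ThS i : closed_span (@EF_words C (g i)) (Th i).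
  by have [] := svalP (projT2 (RRf i)).
have Re i : RR i = hexp (\sum_a \sum_b cst (ratr (B i a b)) *
       pure2 (ugen C (GH a)) (ugen C (GH b))) * (1 + Th i).
  by have [] := svalP (projT2 (RRf i)).
have [T TS e] := csum2_standard_form iotaH iotaC Re ThS (@EF_words_mul G) EF_words_inc.
suff exponent : \sum_u \sum_v cst (ratr (block_diag B u v)) *
      pure2 (ugen C (GH u)) (ugen C (GH v)) =
    \sum_i tens_map (@dsum_inc C n g i)
      (\sum_a \sum_b cst (ratr (B i a b)) * pure2 (ugen C (GH a)) (ugen C (GH b))).
  exists (block_diag B), T; split; [exact: block_diag_inv|exact: TS|].
  by rewrite exponent; exact: e.
rewrite big_dsum; apply: eq_bigr => i _.
have tL := hom_lin (tens_map_hom (@iotaH i)).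
rewrite (hlin_sum tL); apply: eq_bigr => a _; rewrite (hlin_sum tL) big_dsum (bigD1 i) //.
rewrite [\sum_(k | k != i) _]big1 => [|j ji]; last first.
  (* No mixed terms $H_a\otimes H_b$ from different summands occur, as no summand's R-matrix
     contributes any. *)
  have off b : cst (ratr (block_diag B (inc i a) (inc j b))) = 0 :> ctens2 W.
    rewrite block_diag_diff 1?eq_sym // (_ : ratr 0 = 0 :> C) ?cst0 //.
    exact: rmorph0.
  by apply: big1 => b _; rewrite off mul0r.
rewrite Monoid.mulm1; apply: eq_bigr => b _.
rewrite block_diag_same ugenH (ugenH b).
exact: esym (tens_map_pure2Z (@iotaH i) _ _ _).
Qed.

Lemma dsum_universal : universal_R dsum_hopf dsum_R.
Proof. by split; [exact: dsum_quasitriangular|exact: dsum_standard_form]. Qed.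

Lemma dsum_R_shuffle : tens_map phi dsum_R = shuffle (pure RR).
Proof. exact: (shuffle_csum2 cW iotaH iotaC phiH phi_iota). Qed.

(** Needed for $m^-$, which is defined through $R^{-1}$; inverting before or after gluing is the
    same because [csum2] is an algebra map. *)
Lemma hinv_dsum_R : hinv dsum_R = csum2 iota (pure (fun i => hinv (RR i))).
Proof.
have R' i : RR i * hinv (RR i) = 1 /\ hinv (RR i) * RR i = 1.
  have [[[R' [RR' R'R]] _ _ _] _] := RR_univ i.
  by rewrite (hinvE RR' R'R).
by apply: hinvE; apply: (csum2_inv iotaH iotaC) => i; have [] := R' i.
Qed.

Section FRT.
Context (J : 'I_n -> finType) (T : forall i, U i -> J i -> J i -> fps C).
Hypothesis T_rep : forall i, representation (@T i).

Let cU i : hcomplete (U i) := @Uh_complete C (g i).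
Let Tsum u := tens_rep T (phi u).

Let TL (k j : {dffun forall i, J i}) i : hlinear (fun u => @T i u (k i) (j i)).
Proof. by have [] := T_rep i. Qed.

Lemma dsum_mplus (k j : {dffun forall i, J i}) :
  phi (mplus dsum_hopf dsum_R Tsum k j) =
  pure (fun i => mplus (D i) (RR i) (@T i) (k i) (j i)).
Proof. exact: (sum_antipode_lplus cW iotaH iotaC phiH phi_iota cU SH (@TL k j) RR). Qed.

Lemma dsum_mminus (k j : {dffun forall i, J i}) :
  phi (mminus dsum_hopf dsum_R Tsum k j) =
  pure (fun i => mminus (D i) (RR i) (@T i) (k i) (j i)).
Proof.
rewrite /mminus /lminus hinv_dsum_R.
exact: (sum_antipode_lminus cW iotaH iotaC phiH phi_iota cU SH (@TL k j)).
Qed.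

End FRT.
End RMatrix.

Lemma dsum_isoP : dsum_iso phi.
Proof.
split=> //; first exact: (phi_bij cW iotaH iotaC phiH phi_iota csumK).
exact: dsum_phi_ugen.
Qed.

End DirectSumHopf.

Theorem proposition3p3 (R : realType) (n : nat) (hn : (0 < n)%N)
    (g : 'I_n -> cartan) (g_simple : forall i, simple_type (g i))
    (D : forall i, uh_hopf R[i] (g i))
    (RR : forall i, ctens2 (Uh R[i] (g i)))
    (RR_univ : forall i, universal_R (D i) (RR i))
    (J : 'I_n -> finType)
    (T : forall i, Uh R[i] (g i) -> J i -> J i -> fps R[i])
    (T_rep : forall i, representation (T i))
    (T_irr : forall i, irreducible (T i))
    (T_min : forall i, minuscule (T i)) :
  exists (phi : Uh R[i] (dsum g) -> ctens (fun i => Uh R[i] (g i)))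
         (Dsum : uh_hopf R[i] (dsum g)) (Rsum : ctens2 (Uh R[i] (dsum g))),
    let Tsum u := tens_rep T (phi u) in
    [/\ dsum_iso phi,
        universal_R Dsum Rsum,
        tens_map phi Rsum = shuffle (pure RR),
        forall k j : {dffun forall i, J i},
          phi (mplus Dsum Rsum Tsum k j) =
          pure (fun i => mplus (D i) (RR i) (T i) (k i) (j i))
      & forall k j : {dffun forall i, J i},
          phi (mminus Dsum Rsum Tsum k j) =
          pure (fun i => mminus (D i) (RR i) (T i) (k i) (j i))].
Proof.
(* Positivity of the $d_i$, part of finite type, provides the regularity of $q^{d_i}-q^{-d_i}$
   behind the isomorphism. *)
have cd_gt0 i (a : cI (g i)) : (0 < cd a)%N by have [[]] := g_simple i.
exists dsum_phi, (dsum_hopf cd_gt0 D), (dsum_R RR); split.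
- exact: dsum_isoP cd_gt0.
- exact: dsum_universal.
- exact: dsum_R_shuffle cd_gt0 RR.
- exact: dsum_mplus.
- exact: dsum_mminus.
Qed.
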